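(* Let $q\in(1,\infty)\setminus\{2\}$ and let $\mathcal{C}_s=\{\mathrm{id},s\}$ where $s$ is a reflection of $\mathbb{R}^2$ (in a line) that is an isometry of $(\mathbb{R}^2,\|\cdot\|_q)$. Let $(G,m)$ be a $\mathcal{C}_s$-gain graph and let $(\tilde G,\tilde p)$ be a $\mathcal{C}_s$-regular framework in $(\mathbb{R}^2,\|\cdot\|_q)$ derived from $(G,m)$. Then $(\tilde G,\tilde p)$ is minimally $\mathcal{C}_s$-symmetrically infinitesimally rigid if and only if $(G,m)$ is $(2,2,1)$-gain-tight.
   Context: $\|(a_1,a_2)\|_q=(|a_1|^q+|a_2|^q)^{1/q}$. For $a\in\mathbb{R}^2$ and $k>0$ put $a^{(k)}=(\mathrm{sgn}(a_1)|a_1|^k,\mathrm{sgn}(a_2)|a_2|^k)$. For a graph $\tilde G=(\tilde V,\tilde E)$ and $\tilde p:\tilde V\to\mathbb{R}^2$ with $\tilde p(x)\neq\tilde p(y)$ on edges, an infinitesimal motion in $(\mathbb{R}^2,\|\cdot\|_q)$ is a map $u:\tilde V\to\mathbb{R}^2$ with $(\tilde p(x)-\tilde p(y))^{(q-1)}\cdot(u(x)-u(y))=0$ for all edges $\{x,y\}$; trivial motions are the constant maps (translations). Let $\Gamma$ be a group of isometries of the plane. A $\Gamma$-gain graph $(G,m)$ is a finite multigraph $G=(V,E)$ (loops and parallel edges allowed) with each edge oriented and given a gain $m(e)\in\Gamma$, such that parallel edges with the same orientation have distinct gains and loops have non-identity gains; $(v_i,v_j;g)$ denotes an edge from $v_i$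 to $v_j$ with gain $g$. The net gain of a walk is the product of the gains of its edges in order, using the inverse gain for edges traversed backwards; the gain space of a subgraph $H$ at a vertex $v$ is the subgroup generated by net gains of closed walks in $H$ at $v$; $H$ is balanced if all its gain spaces are trivial. The derived graph $\tilde G$ has vertices $\gamma v$ ($\gamma\in\Gamma$, $v\in V$) and edges $\{\gamma v_i,\gamma g v_j\}$ for each edge $(v_i,v_j;g)$ and $\gamma\in\Gamma$ (an edge orbit). A configuration $p:V\to\mathbb{R}^2$ derives $\tilde p(\gamma v)=\gamma p(v)$ (distinct endpoints on edges required), giving the derived framework $(\tilde G,\tilde p)$. A $\Gamma$-symmetric infinitesimal motion is an infinitesimal motion $u$ with $u(\gamma x)=\gamma_l u(x)$, $\gamma_l$ the linear part of $\gamma$. The framework is $\Gamma$-symmetrically infinitesimally rigid if every $\Gamma$-symmetric infinitesimal motion is trivial (constant), and minimally so if also removing any single edge orbit destroys this. $\tilde p$ is $\Gamma$-regular if the dimension of the space of $\Gamma$-symmetric infinitesimal motions is minimal among all $\Gamma$-symmetric configurations of $\tilde G$. A multigraph is $(k,l)$-sparse if every subgraph with $|E'|\ge1$ satisfies $|E'|\le k|V'|-l$, and $(k,l)$-tight if moreover $|E|=k|V|-l$. A gain graph is $(2,2,1)$-gain-tight if $G$ is $(2,1)$-tight and every balanced subgraph is $(2,2)$-sparse.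
   Formalization: The vertex set is assumed nonempty, and a gain graph may not contain both (v_i,v_j;g) and (v_j,v_i;g^-1) as distinct edges, since these would derive the same edge orbit and the equivalence would fail. *)

(* Defs.v *)
From HB Require Import structures.
From mathcomp Require Import all_boot all_order all_algebra all_fingroup.
From mathcomp Require Import boolp reals exp.

Set Implicit Arguments.
Unset Strict Implicit.
Unset Printing Implicit Defensive.

Import Order.TTheory GRing.Theory Num.Theory.

Local Open Scope ring_scope.

(** ** The plane *)

Definition dot (R : realType) (a b : 'rV[R]_2) : R := \sum_i a 0 i * b 0 i.

Definition lq_norm (R : realType) (q : R) (a : 'rV[R]_2) : R :=
  powR (\sum_i powR `|a 0 i| q) q^-1.

Definition signed_pow (R : realType) (k : R) (a : 'rV[R]_2) : 'rV[R]_2 :=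
  \row_i (Num.sg (a 0 i) * powR `|a 0 i| k).

Definition lq_isometry (R : realType) (q : R) (f : 'rV[R]_2 -> 'rV[R]_2) : Prop :=
  forall x y, lq_norm q (f x - f y) = lq_norm q (x - y).

(* Euclidean reflection in the line through [c] orthogonal to [n]; the line
   need not contain the origin. *)
Definition is_reflection (R : realType) (f : 'rV[R]_2 -> 'rV[R]_2) : Prop :=
  exists c n : 'rV[R]_2, n != 0 /\
    forall x, f x = x - (2 * dot (x - c) n / dot n n) *: n.

Definition linear_part (R : realType) (f : 'rV[R]_2 -> 'rV[R]_2) (x : 'rV[R]_2) :
  'rV[R]_2 := f x - f 0.

(** ** Gain graphs *)

(* [src e] and [tgt e] are the ends of [e] in its chosen orientation.  Reversing
   an edge inverts its gain, so "parallel edges with the same orientation have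
   distinct gains" also constrains oppositely oriented parallel edges: this is
   [parallel_gain_rev].  Without it two edges could derive the same edge orbit. *)
Record gain_graph (gT : finGroupType) (V E : finType) := GainGraph {
  src : E -> V;
  tgt : E -> V;
  gain : E -> gT;
  loop_gain : forall e, src e = tgt e -> gain e != 1%g;
  parallel_gain : forall e f,
    src e = src f -> tgt e = tgt f -> gain e = gain f -> e = f;
  parallel_gain_rev : forall e f,
    src e = tgt f -> tgt e = src f -> gain e = (gain f)^-1%g -> e = f
}.

Definition subgraph (gT : finGroupType) (V E : finType) (G : gain_graph gT V E)
    (W : {set V}) (F : {set E}) : Prop :=
  forall e, e \in F -> src G e \in W /\ tgt G e \in W.

(* A step [(e, b)] of a walk traverses [e] forwards if [b] is false and
   backwards if [b] is true. *)
Definition step_src (gT : finGroupType) (V E : finType) (G : gain_graph gT V E)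
  (st : E * bool) : V := if st.2 then tgt G st.1 else src G st.1.

Definition step_tgt (gT : finGroupType) (V E : finType) (G : gain_graph gT V E)
  (st : E * bool) : V := if st.2 then src G st.1 else tgt G st.1.

Definition step_gain (gT : finGroupType) (V E : finType) (G : gain_graph gT V E)
  (st : E * bool) : gT := if st.2 then ((gain G st.1)^-1)%g else gain G st.1.

Fixpoint is_walk (gT : finGroupType) (V E : finType) (G : gain_graph gT V E)
    (F : {set E}) (u : V) (w : seq (E * bool)) (v : V) : bool :=
  if w is st :: w' then
    [&& st.1 \in F, step_src G st == u & is_walk G F (step_tgt G st) w' v]
  else u == v.

Definition net_gain (gT : finGroupType) (V E : finType) (G : gain_graph gT V E)
  (w : seq (E * bool)) : gT := (\prod_(st <- w) step_gain G st)%g.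

Definition gain_space (gT : finGroupType) (V E : finType) (G : gain_graph gT V E)
    (F : {set E}) (v : V) : {set gT} :=
  <<[set g | `[< exists2 w, is_walk G F v w v & net_gain G w = g >]]>>%g.

Definition balanced (gT : finGroupType) (V E : finType) (G : gain_graph gT V E)
    (W : {set V}) (F : {set E}) : Prop :=
  forall v, v \in W -> gain_space G F v = 1%g.

(** ** Sparsity *)

Definition sparse (gT : finGroupType) (V E : finType) (G : gain_graph gT V E)
    (k l : nat) (W : {set V}) (F : {set E}) : Prop :=
  forall (W' : {set V}) (F' : {set E}),
    W' \subset W -> F' \subset F -> subgraph G W' F' ->
    (1 <= #|F'|)%N -> (#|F'| + l <= k * #|W'|)%N.

Definition tight (gT : finGroupType) (V E : finType) (G : gain_graph gT V E)
    (k l : nat) : Prop :=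
  sparse G k l [set: V] [set: E] /\ (#|E| + l = k * #|V|)%N.

Definition gain_tight (gT : finGroupType) (V E : finType) (G : gain_graph gT V E)
    (k l m : nat) : Prop :=
  tight G k m /\
  forall (W : {set V}) (F : {set E}),
    subgraph G W F -> balanced G W F -> sparse G k l W F.

(** ** Derived graphs

    The pair [(g, v)] stands for the vertex [g v] of the derived graph, and a
    set of edges on [T] is a set of unordered pairs [[set x; y]]. *)

Definition edge_orbit (gT : finGroupType) (V E : finType) (G : gain_graph gT V E)
    (e : E) : {set {set gT * V}} :=
  [set [set (g, src G e); ((g * gain G e)%g, tgt G e)] | g : gT].

Definition derived_edges (gT : finGroupType) (V E : finType)
    (G : gain_graph gT V E) : {set {set gT * V}} :=
  \bigcup_(e : E) edge_orbit G e.

Definition vertex_act (gT : finGroupType) (V : finType) (g : gT) (x : gT * V) :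
  gT * V := ((g * x.1)%g, x.2).

Definition derived_conf (R : realType) (gT : finGroupType)
    (act : gT -> 'rV[R]_2 -> 'rV[R]_2) (V : finType) (p : V -> 'rV[R]_2)
    (x : gT * V) : 'rV[R]_2 :=
  act x.1 (p x.2).

(** ** Frameworks and infinitesimal motions *)

Definition well_positioned (R : realType) (T : finType) (D : {set {set T}})
    (pt : T -> 'rV[R]_2) : Prop :=
  forall x y, [set x; y] \in D -> pt x != pt y.

Definition symmetric_conf (R : realType) (gT : finGroupType)
    (act : gT -> 'rV[R]_2 -> 'rV[R]_2) (V : finType)
    (pt : gT * V -> 'rV[R]_2) : Prop :=
  forall g x, pt (vertex_act g x) = act g (pt x).

Definition inf_motion (R : realType) (q : R) (T : finType) (D : {set {set T}})
    (pt : T -> 'rV[R]_2) (u : {ffun T -> 'rV[R]_2}) : Prop :=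
  forall x y, [set x; y] \in D ->
    dot (signed_pow (q - 1) (pt x - pt y)) (u x - u y) = 0.

Definition symmetric_motion (R : realType) (q : R) (gT : finGroupType)
    (act : gT -> 'rV[R]_2 -> 'rV[R]_2) (V : finType) (D : {set {set gT * V}})
    (pt : gT * V -> 'rV[R]_2) (u : {ffun gT * V -> 'rV[R]_2}) : Prop :=
  inf_motion q D pt u /\
  forall g x, u (vertex_act g x) = linear_part (act g) (u x).

Definition symmetrically_rigid (R : realType) (q : R) (gT : finGroupType)
    (act : gT -> 'rV[R]_2 -> 'rV[R]_2) (V : finType) (D : {set {set gT * V}})
    (pt : gT * V -> 'rV[R]_2) : Prop :=
  forall u, symmetric_motion q act D pt u -> forall x y, u x = u y.

Definition minimally_symmetrically_rigid (R : realType) (q : R)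
    (gT : finGroupType) (act : gT -> 'rV[R]_2 -> 'rV[R]_2) (V E : finType)
    (G : gain_graph gT V E) (pt : gT * V -> 'rV[R]_2) : Prop :=
  symmetrically_rigid q act (derived_edges G) pt /\
  forall e, ~ symmetrically_rigid q act (derived_edges G :\: edge_orbit G e) pt.

Definition has_dim (K : fieldType) (vT : vectType K) (P : vT -> Prop) (d : nat) :
  Prop := exists2 U : {vspace vT}, (forall u, u \in U <-> P u) & \dim U = d.

Definition regular_conf (R : realType) (q : R) (gT : finGroupType)
    (act : gT -> 'rV[R]_2 -> 'rV[R]_2) (V : finType) (D : {set {set gT * V}})
    (pt : gT * V -> 'rV[R]_2) : Prop :=
  exists2 d, has_dim (symmetric_motion q act D pt) d &
    forall (pt' : gT * V -> 'rV[R]_2) (d' : nat),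
      well_positioned D pt' -> symmetric_conf act pt' ->
      has_dim (symmetric_motion q act D pt') d' -> (d <= d')%N.

(** ** The group generated by a reflection *)

(* [true] stands for the reflection [s] and [false] for the identity. *)
Definition Cs : Type := bool.

HB.instance Definition _ := Finite.on Cs.
HB.instance Definition _ := Finite_isGroup.Build Cs addbA addFb addbb.

Definition Cs_act (R : realType) (s : 'rV[R]_2 -> 'rV[R]_2) (b : Cs) :
  'rV[R]_2 -> 'rV[R]_2 := if b then s else id.

(** ** Sanity checks: [has_dim] is functional, and is total on the spaces of
    symmetric motions. *)

Lemma has_dim_inj (K : fieldType) (vT : vectType K) (P : vT -> Prop) (d d' : nat) :
  has_dim P d -> has_dim P d' -> d = d'.
Proof.
move=> [U UP <-] [U' UP' <-]; congr (\dim _); apply/vspaceP => u.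
by apply/idP/idP => [/UP/UP'|/UP'/UP].
Qed.

Lemma has_dim_ex (K : fieldType) (vT : vectType K) (P : vT -> Prop) :
  P 0 -> (forall a u v, P u -> P v -> P (a *: u + v)) -> exists d, has_dim P d.
Proof.
move=> P0 PL.
pose Q n := `[< exists2 U : {vspace vT}, (forall u, u \in U -> P u) & \dim U = n >].
have exQ : exists n, Q n.
  by exists 0; apply/asboolP; exists 0%VS; rewrite ?dimv0// => u /[!memv0]/eqP->.
have bQ n : Q n -> (n <= \dim {:vT})%N.
  by move=> /asboolP[U _ <-]; rewrite dimvS ?subvf.
case: (ex_maxnP exQ bQ) => n /asboolP[U UP dU] nmax.
exists n, U => // u; split => [/UP//|Pu].
have : Q (\dim (U + <[u]>)).
  apply/asboolP; exists (U + <[u]>)%VS => // _ /memv_addP[v vU [_ /vlineP[a ->] ->]].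
  by rewrite addrC; apply: PL => //; apply: UP.
move=> /nmax; rewrite -dU => le.
have /eqP-> : U == (U + <[u]>)%VS by rewrite eqEdim addvSl.
by apply: (subvP (addvSr U _)); apply: memv_line.
Qed.

Lemma Cs_has_dim (R : realType) (q : R) (s : 'rV[R]_2 -> 'rV[R]_2) (V : finType)
    (D : {set {set Cs * V}}) (pt : Cs * V -> 'rV[R]_2) :
  is_reflection s -> exists d, has_dim (symmetric_motion q (Cs_act s) D pt) d.
Proof.
move=> [c [n [n0 sE]]].
have dotD (x y z : 'rV[R]_2) a : dot x (a *: y + z) = a * dot x y + dot x z.
  rewrite /dot mulr_sumr -big_split; apply: eq_bigr => i _.
  by rewrite !mxE mulrDr mulrCA.
have dotC (x y : 'rV[R]_2) : dot x y = dot y x.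
  by apply: eq_bigr => i _; rewrite mulrC.
have cancel (x y z : 'rV[R]_2) : x - (y + z) - (0 - z) = x - y.
  by rewrite sub0r opprK opprD addrA subrK.
have slin x : linear_part s x = x - (2 * dot x n / dot n n) *: n.
  have dE : dot (x - c) n = dot x n + dot (0 - c) n.
    by rewrite dotC -(scale1r x) sub0r dotD mul1r !(dotC n) scale1r.
  by rewrite /linear_part !sE dE mulrDr mulrDl scalerDl cancel.
have lin b a u v :
    linear_part (Cs_act s b) (a *: u + v) =
    a *: linear_part (Cs_act s b) u + linear_part (Cs_act s b) v.
  case: b; last by rewrite /linear_part /= !subr0.
  rewrite !slin dotC dotD !(dotC n) mulrDr mulrDl scalerDl scalerBr scalerA.
  by rewrite [2 * (a * _)]mulrCA -!mulrA opprD addrACA.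
apply: has_dim_ex => [|a u v [u1 u2] [v1 v2]]; split.
- by move=> x y _; rewrite !ffunE subrr /dot big1// => i _; rewrite [X in _ * X]mxE mulr0.
- by move=> g x; rewrite !ffunE /linear_part subrr.
- move=> x y xy; have -> : (a *: u + v) x - (a *: u + v) y =
      a *: (u x - u y) + (v x - v y).
    by rewrite !ffunE scalerBr opprD addrACA.
  by rewrite dotD u1// v1// mulr0 addr0.
- by move=> g x; rewrite !ffunE lin u2 v2.
Qed.

(* Main.v *)
Require Import Defs.
From HB Require Import structures.
From mathcomp Require Import classical_sets topology normedtype sequences.
From mathcomp Require Import ring lra zify.
From mathcomp Require Import all_boot all_order all_algebra all_fingroup.
From mathcomp Require Import boolp reals exp.

(** In gauge form a symmetric motion is a map on [V], and the edge [(x, y; g)]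
    imposes one linear equation on it, so the theorem reduces to the rank of
    the resulting matrix.  Its rows are independent only if the edge counts
    hold, because a balanced subgraph carries a two-dimensional space of
    trivial motions and any subgraph a one-dimensional one.

    Conversely, a gain-sparse edge set has an independent placement, by
    induction on the number of edges.  If a balanced tight proper subset
    exists, a maximal one is contracted: a placement of the contraction, with
    the contracted vertex blown up to a tiny copy of a placement of the subset,
    is independent.  Otherwise a vertex of degree at most two is removed, or a
    vertex of degree three is removed and an edge is put between two of its
    neighbours.  If this fails for all three pairs of neighbours, submodularity
    of the counts shows that the graph is a balanced [K_4], for which an
    explicit placement works because [q != 2]. *)
Set Implicit Arguments.
Unset Strict Implicit.
Unset Printing Implicit Defensive.

Import Order.TTheory GRing.Theory Num.Theory.
Import numFieldNormedType.Exports.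

(** * Gain-sparse edge sets *)

Section GainSparse.
Variable V : finType.

(** The edge weights [signed_pow] are nonlinear in the positions, so no polynomial genericity
    argument applies directly. The constructions rely on oddness, homogeneity, injectivity and
    continuity of the power: a midpoint keeps a direction up to scaling, a copy shrunk by t has its
    rows multiplied by a power of t, and independence survives small perturbations. Balanced tight
    sets are contracted before a vertex is removed because they too can forbid the new edge between
    neighbours. Once only the whole set can be balanced and tight, every obstruction is an
    unbalanced tight set, and such sets are closed under union as soon as they meet. One independent
    placement is enough: a regular configuration has a motion space of minimal dimension, so it is
    at least as rigid as that placement. *)

Definition gedge := (V * V * bool)%type.
Implicit Types (g h k : bool) (d : gedge) (F H : {set gedge}) (W : {set V}) (x y v w : V).

(** The group has order two, so a gain is its own inverse and an edge may be reversed without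
    changing its gain. Sorting the ends by [enum_rank] picks one triple for each undirected gain
    edge. *)
Definition ed x y (g : bool) : gedge :=
  if (enum_rank x <= enum_rank y)%N then (x, y, g) else (y, x, g).

Definition ends d : {set V} := [set d.1.1; d.1.2].
Definition vs F : {set V} := \bigcup_(d in F) ends d.

Definition oriented F :=
  forall d, d \in F -> ed d.1.1 d.1.2 d.2 = d /\ (d.1.1 = d.1.2 -> d.2).

(** A switching function: changing the gauge by [psi] makes every gain in [F] trivial. Its existence
    is equivalent to balance, which becomes a condition on edges instead of closed walks. *)
Definition potential F (psi : {ffun V -> bool}) :=
  [forall d in F, d.2 == psi d.1.1 (+) psi d.1.2].
Definition bal F := [exists psi, potential F psi].

Definition gsparse F := forall H, H \subset F -> H != set0 ->
  (#|H| + 1 <= 2 * #|vs H|)%N /\ (bal H -> (#|H| + 2 <= 2 * #|vs H|)%N).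

Lemma edC x y g : ed x y g = ed y x g.
Proof.
rewrite /ed; case: (leqP (enum_rank x) (enum_rank y)) => [le_xy|lt_yx].
  case: leqP => // le_yx; suff -> : x = y by [].
  by apply: enum_rank_inj; apply: ord_inj; apply/eqP; rewrite eqn_leq le_xy.
by rewrite ltnW.
Qed.

Lemma ed2 x y g : (ed x y g).2 = g.
Proof. by rewrite /ed; case: ifP. Qed.

Lemma ends_ed x y g : ends (ed x y g) = [set x; y].
Proof. by rewrite /ends /ed; case: ifP => _ //=; rewrite setUC. Qed.

Lemma edP x y g : (ed x y g = (x, y, g)) \/ (ed x y g = (y, x, g)).
Proof. by rewrite /ed; case: ifP => _; [left | right]. Qed.

Lemma ed_idem x y g :
  ed (ed x y g).1.1 (ed x y g).1.2 (ed x y g).2 = ed x y g.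
Proof. by case: (edP x y g) => e; rewrite e /= ?(edC y x) e. Qed.

Lemma ed_inj x y g x' y' g' : ed x y g = ed x' y' g' ->
  g = g' /\ ((x = x' /\ y = y') \/ (x = y' /\ y = x')).
Proof.
by case: (edP x y g) => ->; case: (edP x' y' g') => -> [-> -> ->]; split; auto.
Qed.

Lemma ed_inj1 v x y g h : ed v x g = ed v y h -> (g, x) = (h, y).
Proof. by move/ed_inj => [-> [[_ ->]|[-> ->]]]. Qed.

Lemma ed_loop x y g : ((ed x y g).1.1 == (ed x y g).1.2) = (x == y).
Proof. by case: (edP x y g) => -> //=; apply: eq_sym. Qed.

Lemma potential_ed (psi : {ffun V -> bool}) x y g :
  ((ed x y g).2 == psi (ed x y g).1.1 (+) psi (ed x y g).1.2) =
  (g == psi x (+) psi y).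
Proof. by case: (edP x y g) => -> //=; rewrite addbC. Qed.

Lemma normal_ed F d v : oriented F -> d \in F -> v \in ends d ->
  exists x, d = ed v x d.2 /\ (x = v -> d.2).
Proof.
move=> nF dF; have [dE dl] := nF _ dF; rewrite !inE => /orP[]/eqP ->.
  by exists d.1.2; rewrite dE; split=> // e; apply: dl.
by exists d.1.1; rewrite edC dE.
Qed.

Lemma normalS F H : H \subset F -> oriented F -> oriented H.
Proof. by move=> /subsetP s nF d /s/nF. Qed.

Lemma gsparseS F H : H \subset F -> gsparse F -> gsparse H.
Proof. by move=> s sF K sK; apply: sF; apply: subset_trans sK s. Qed.

Lemma vsS F H : H \subset F -> vs H \subset vs F.
Proof.
move=> /subsetP s; apply/bigcupsP => d dH.
exact: (bigcup_sup d (s _ dH)).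
Qed.

Lemma vsU F H : vs (F :|: H) = vs F :|: vs H.
Proof. exact: bigcup_setU. Qed.

Lemma vsU1 d F : vs (d |: F) = ends d :|: vs F.
Proof. by rewrite vsU /vs big_set1. Qed.

Lemma vs1 d : vs [set d] = ends d.
Proof. by rewrite /vs big_set1. Qed.

Lemma vsP F v : reflect (exists2 d, d \in F & v \in ends d) (v \in vs F).
Proof. exact: bigcupP. Qed.

Lemma balS F H : H \subset F -> bal F -> bal H.
Proof.
move=> /subsetP s /existsP[psi /forall_inP pF]; apply/existsP; exists psi.
by apply/forall_inP => d /s/pF.
Qed.

Definition incident F v := [set d in F | v \in ends d].

Lemma incident_compl F v : v \notin vs (F :\: incident F v).
Proof.
by apply/vsP => -[d]; rewrite !inE negb_and => /andP[/orP[/negP|/negP ?]//] ->.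
Qed.

(** Handshake count: the degrees, loops counted twice, sum to 2|F| < 4|vs F|, so some degree is at
    most three. [incident] counts a loop once, hence a loop at that vertex already brings the number
    of incident edges down to two. *)
Lemma low_degree F : oriented F -> gsparse F -> F != set0 ->
  exists2 v, v \in vs F &
    (#|incident F v| <= 2)%N \/
    (#|incident F v| = 3 /\ forall d, d \in incident F v -> d.1.1 != d.1.2).
Proof.
move=> nF sF F0.
have [bF _] := sF F (subxx _) F0.
pose deg v := (\sum_(d in F) ((v == d.1.1) + (v == d.1.2)))%N.
have sumdeg : (\sum_(v in vs F) deg v = #|F| * 2)%N.
  rewrite exchange_big /= -sum_nat_const; apply: eq_bigr => d dF.
  have one z : z \in ends d -> (\sum_(v in vs F) (v == z) = 1)%N.
    move=> zd; rewrite (bigD1 z) /=; last by apply/vsP; exists d.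
    by rewrite eqxx big1 // => i /andP[_ /negPf ->].
  by rewrite big_split /= !one // !inE eqxx ?orbT.
have [v vF dv] : exists2 v, v \in vs F & (deg v <= 3)%N.
  case: (boolP [exists v in vs F, deg v <= 3]%N) => [/exists_inP //|].
  move=> /exists_inPn big; exfalso.
  have : (\sum_(v in vs F) 4 <= \sum_(v in vs F) deg v)%N.
    by apply: leq_sum => v /big; rewrite -ltnNge.
  by rewrite sumdeg sum_nat_const; lia.
exists v => //.
have degE : deg v =
    (#|incident F v| + #|[set d in F | (v == d.1.1) && (v == d.1.2)]|)%N.
  have cE (A : {set gedge}) : #|A| = (\sum_d (d \in A))%N.
    by rewrite -sum1_card big_mkcond /=; apply: eq_bigr => d _; case: (d \in A).
  rewrite !cE -big_split /= /deg big_mkcond /=.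
  apply: eq_bigr => d _; rewrite !inE.
  by case: (d \in F) => //=; do 2 case: (v == _).
case: (posnP #|[set d in F | (v == d.1.1) && (v == d.1.2)]|) => l0; last first.
  by left; lia.
case: (leqP #|incident F v| 2) => i2; [by left | right; split; first by lia].
move=> d; rewrite !inE => /andP[dF vd]; apply: contraT; rewrite negbK => /eqP e.
have : d \in [set d in F | (v == d.1.1) && (v == d.1.2)].
  by rewrite !inE dF -e; move: vd; rewrite -e orbb => ->.
by rewrite (cards0_eq l0) inE.
Qed.

(** * Unbalanced tight sets and blocked edges *)

Definition utight H := (#|H| + 1 == 2 * #|vs H|)%N.

(** A [utight] subset of a gain-sparse set is unbalanced, since it exceeds the balanced count. The
    sizes of union and intersection add up to those of the two sets, and the bound on the
    intersection leaves the union no slack. *)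
Lemma utightU F H1 H2 : gsparse F -> H1 \subset F -> H2 \subset F ->
  utight H1 -> utight H2 -> vs H1 :&: vs H2 != set0 -> utight (H1 :|: H2).
Proof.
move=> sF s1 s2 /eqP t1 /eqP t2 ne; apply/eqP.
have cU := cardsUI H1 H2; have cV := cardsUI (vs H1) (vs H2).
have pI : (0 < #|vs H1 :&: vs H2|)%N by rewrite card_gt0.
have h10 : H1 != set0.
  by apply: contraTneq ne => ->; rewrite /vs big_set0 set0I negbK.
have [] := sF (H1 :|: H2); rewrite ?subUset ?s1 //.
  by rewrite setU_eq0 negb_and h10.
rewrite vsU => leU _.
have sI : vs (H1 :&: H2) \subset vs H1 :&: vs H2.
  by rewrite subsetI !vsS ?subsetIl ?subsetIr.
have := subset_leq_card sI.
(* Without a common edge, a shared vertex alone would push the union past its bound, so this case is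
   contradictory. *)
case: (eqVneq (H1 :&: H2) set0) => [I0|I0]; first by move: cU; rewrite I0 cards0; lia.
by have [] := sF (H1 :&: H2) (subset_trans (subsetIl _ _) s1) I0; lia.
Qed.

(** One new vertex with two new edges adds two to both sides of the count. *)
Lemma utight_ext F H x y z g h : gsparse F -> H \subset F -> utight H ->
  ed x y g \in F -> ed x z h \in F -> ed x y g != ed x z h ->
  y \in vs H -> z \in vs H ->
  exists H', [/\ utight H', H' \subset F, H \subset H' & x \in vs H'].
Proof.
move=> sF sH tH e1 e2 ne yH zH.
have [xH|xH] := boolP (x \in vs H); first by exists H.
have nH a k : ed x a k \notin H.
  apply: contra xH => exH; apply/vsP; exists (ed x a k) => //.
  by rewrite ends_ed !inE eqxx.
exists (ed x y g |: (ed x z h |: H)); split.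
- rewrite /utight !vsU1 !cardsU1 !ends_ed in_setU1 negb_or ne !nH.
  have -> : [set x; y] :|: ([set x; z] :|: vs H) = x |: vs H.
    apply/setP => t; rewrite !inE.
    case: (eqVneq t y) => [->|]; first by rewrite yH !orbT.
    by case: (eqVneq t z) => [->|]; rewrite ?zH ?orbT //=; case: (t == x).
  by rewrite cardsU1 xH; move/eqP: tH => /=; lia.
- by rewrite !subUset !sub1set e1 e2.
- by rewrite setUA subsetUr.
by rewrite vsU1 ends_ed !inE eqxx.
Qed.

Definition btight H :=
  [&& H != set0, bal H & (#|H| + 2 == 2 * #|vs H|)%N].


(** The obstructions to inserting an edge that come from the unbalanced count or from the edge being
    present. Balanced tight sets are handled by a separate hypothesis of [gsparse_add]. *)
Definition blocked F x y g :=
  (ed x y g \in F) \/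
  exists H, [/\ utight H, H \subset F, x \in vs H & y \in vs H].

(** A violation must contain the new edge; deleting it leaves [K] inside [F0]. If [K] covers both
    ends, it would be tight: for the unbalanced count this is a block, for the balanced one [K]
    would be all of [F], impossible inside the proper subset [F0]. If [K] misses an end, the extra
    vertex pays for the edge. *)
Lemma gsparse_add F F0 x y g : oriented F -> gsparse F -> F0 \proper F ->
  (forall H, btight H -> H \subset F -> H = F) ->
  (x = y -> g) -> ~ blocked F0 x y g ->
  oriented (ed x y g |: F0) /\ gsparse (ed x y g |: F0).
Proof.
move=> nF sF prF nb lg nbl; have sF0 := proper_sub prF.
have eF0 : ed x y g \notin F0 by apply/negP => ?; apply: nbl; left.
split.
  move=> d; rewrite in_setU1 => /orP[/eqP ->|/(normalS sF0 nF) //].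
  by split; [exact: ed_idem | move/eqP; rewrite ed_loop ed2 => /eqP].
move=> H sH H0.
have [eH|eH] := boolP (ed x y g \in H); last first.
  apply: (gsparseS sF0 sF) => //; apply/subsetP => d dH.
  have := subsetP sH _ dH; rewrite in_setU1 => /orP[/eqP e|//].
  by rewrite e (negPf eH) in dH.
pose K := H :\ ed x y g.
have HE : H = ed x y g |: K by rewrite setD1K.
have eK : ed x y g \notin K by rewrite !inE eqxx.
have sK : K \subset F0.
  apply/subsetP => d; rewrite in_setD1 => /andP[ne /(subsetP sH)].
  by rewrite in_setU1 (negPf ne).
have sKF := subset_trans sK sF0.
have cH : (#|H| = #|K|.+1)%N by rewrite HE cardsU1 eK.
have vH : vs H = [set x; y] :|: vs K by rewrite HE vsU1 ends_ed.
(* A potential forces gain [false] on a loop, whereas loops here have gain [true]. *)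
have nl : bal H -> x != y.
  move=> /existsP[psi /forall_inP /(_ _ eH)]; rewrite potential_ed => /eqP gE.
  by apply/eqP => xy; have := lg xy; rewrite gE xy addbb.
have [K0|K0] := eqVneq K set0.
  have -> : vs H = [set x; y] by rewrite vH K0 /vs big_set0 setU0.
  rewrite cH K0 cards0 cards2; split=> [|/nl ->] //.
  by case: (x != y).
have [bK sK2] := sF K sKF K0.
have le1 : (#|vs K| <= #|vs H|)%N by rewrite vH subset_leq_card ?subsetUr.
case: (boolP ((x \in vs K) && (y \in vs K))) => [/andP[xK yK]|out].
  have nu : ~~ utight K.
    by apply/negP => tK; apply: nbl; right; exists K.
  have nt : bal K -> (#|K| + 2 != 2 * #|vs K|)%N.
    move=> bK'; apply/negP => tK.
    have KF : K = F by apply: nb; rewrite // /btight K0 bK'.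
    by case/properP: prF => _ [d dF /negP]; apply; rewrite -KF in dF; apply: (subsetP sK).
  split; first by move: nu; rewrite /utight; clear -bK cH le1; lia.
  move=> bH; have bK' : bal K by apply: balS bH; rewrite HE subsetUr.
  by move: (sK2 bK') (nt bK'); clear -cH le1; lia.
have lt1 : (#|vs K| < #|vs H|)%N.
  apply: proper_card; rewrite properE vH subsetUr /=.
  apply: contra out => /subsetP so.
  by rewrite !so // !inE eqxx ?orbT.
split; first by clear -bK cH lt1; lia.
move=> bH; have bK' : bal K by apply: balS bH; rewrite HE subsetUr.
by move: (sK2 bK'); clear -cH lt1; lia.
Qed.

Lemma ed_loop_utight x g : utight [set ed x x g].
Proof. by rewrite /utight cards1 vs1 ends_ed setUid cards1. Qed.

(** No tight set in [F0] covers x, y and z, since restoring v with its three edges would exceed the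
    bound. So two pairs are never both blocked by tight sets (take the union), nor is one blocked by
    a tight set while the others are edges ([utight_ext]). All three pairs are therefore edges; with
    those at v they form a balanced tight set, which must be [F]. *)
Lemma all_blocked F v x y z g h k : oriented F -> gsparse F ->
  incident F v = [set ed v x g; ed v y h; ed v z k] ->
  #|incident F v| = 3 ->
  (forall H, btight H -> H \subset F -> H = F) ->
  x != v -> y != v -> z != v ->
  (g, x) != (h, y) -> (g, x) != (k, z) -> (h, y) != (k, z) ->
  blocked (F :\: incident F v) x y (g (+) h) ->
  blocked (F :\: incident F v) x z (g (+) k) ->
  blocked (F :\: incident F v) y z (h (+) k) ->
  [/\ x != y, x != z, y != z &
    F = [set ed v x g; ed v y h; ed v z k;
             ed x y (g (+) h); ed x z (g (+) k); ed y z (h (+) k)]].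
Proof.
move=> nF sF iE i3 nb xv yv zv xy xz yz.
set F0 := F :\: incident F v => bxy bxz byz.
have sF0 : F0 \subset F by rewrite subsetDl.
have vF0 : v \notin vs F0 := incident_compl F v.
have iF : incident F v \subset F by apply/subsetP => d; rewrite !inE => /andP[].
have no3 H : utight H -> H \subset F0 -> x \in vs H -> y \in vs H -> z \in vs H -> False.
  move=> /eqP tH sH xH yH zH.
  have [] := sF (H :|: incident F v).
  - by rewrite subUset (subset_trans sH).
  - by rewrite setU_eq0 negb_and -!card_gt0 i3 orbT.
  have -> : vs (H :|: incident F v) = v |: vs H.
    rewrite vsU iE !vsU !vs1 !ends_ed; apply/setP => t; rewrite !inE.
    have [->|_] := eqVneq t x; first by rewrite xH !orbT.
    have [->|_] := eqVneq t y; first by rewrite yH !orbT.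
    have [->|_] := eqVneq t z; first by rewrite zH !orbT.
    by rewrite !orbF !orbb orbC.
  rewrite cardsU1 (contra (subsetP (vsS sH) v) vF0) cardsU.
  suff -> : H :&: incident F v = set0.
    by rewrite cards0 i3 => le _; move: tH le; clear; lia.
  apply/eqP; rewrite setI_eq0; apply/pred0P => d /=.
  by apply/negP => /andP[/(subsetP sH)]; rewrite in_setD => /andP[/negPf ->].
have sGF0 := gsparseS sF0 sF.
pose B a b := exists H, [/\ utight H, H \subset F0, a \in vs H & b \in vs H].
(* two tight unbalanced subgraphs through a common neighbour *)
have BB a b c : (forall H, utight H -> H \subset F0 -> a \in vs H -> b \in vs H ->
    c \in vs H -> False) -> B a b -> B a c -> False.
  move=> no [H [tH sH aH bH]] [K [tK sK aK cK]].
  apply: (no (H :|: K)); rewrite ?subUset ?sH // ?vsU ?inE ?aH ?bH ?cK ?orbT //.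
  apply: (utightU sGF0) => //; apply/set0Pn; exists a; by rewrite inE aH.
have BE a b c m n : (forall H, utight H -> H \subset F0 -> a \in vs H -> b \in vs H ->
    c \in vs H -> False) -> ed a b m \in F0 -> ed a c n \in F0 -> (m, b) != (n, c) ->
    B b c -> False.
  move=> no e1 e2 ne [H [tH sH bH cH]].
  have ne' : ed a b m != ed a c n by apply: contra ne => /eqP/ed_inj1 ->.
  have [H' [tH' sH' HH' aH']] := utight_ext sGF0 sH tH e1 e2 ne' bH cH.
  by apply: (no H') => //; apply: (subsetP (vsS HH')).
have Bs a b : B a b -> B b a by move=> [H [? ? ? ?]]; exists H.
have sh (m n l : bool) a b : (m, a) != (n, b) -> (l (+) m, a) != (l (+) n, b).
  by apply: contra => /eqP[/addbI -> ->].
have nBxy : ~ B x y.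
  move=> b; case: bxz => [exz|]; last by apply: BB b; apply: no3.
  case: byz => [eyz|/(BB _ _ _ _ (Bs _ _ b)) no]; last first.
    by apply: no => H ? ? ? ? ?; apply: (no3 H).
  rewrite edC in exz; rewrite edC in eyz; apply: (BE _ _ _ _ _ _ exz eyz _ b).
    by move=> H ? ? ? ? ?; apply: (no3 H).
  by rewrite !(addbC _ k); apply: sh.
have nBxz : ~ B x z.
  move=> b; case: bxy => [exy|//].
  case: byz => [eyz|c]; last first.
    by apply: (BB z x y) => [H ? ? ? ? ?||]; [apply: (no3 H)|apply: Bs|apply: Bs].
  rewrite edC in exy; apply: (BE _ _ _ _ _ _ exy eyz _ b).
    by move=> H ? ? ? ? ?; apply: (no3 H).
  by rewrite (addbC g); apply: sh.
have nByz : ~ B y z.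
  move=> b; case: bxy => [exy|//]; case: bxz => [exz|//].
  by apply: (BE _ _ _ _ _ no3 exy exz _ b); apply: sh.
case: bxy => [exy|//]; case: bxz => [exz|//]; case: byz => [eyz|//].
(* Were two neighbours equal, the edge between them would be a loop, which by itself is a tight
   set. *)
have loop a m : ed a a m \in F0 -> B a a.
  move=> e; exists [set ed a a m]; split; rewrite ?ed_loop_utight ?sub1set //;
  by rewrite vs1 ends_ed !inE eqxx.
have xy' : x != y by apply/eqP => e; apply: nBxy; rewrite -e in exy *; apply: loop exy.
have xz' : x != z by apply/eqP => e; apply: nBxz; rewrite -e in exz *; apply: loop exz.
have yz' : y != z by apply/eqP => e; apply: nByz; rewrite -e in eyz *; apply: loop eyz.
split=> //; symmetry.
pose T := [set ed x y (g (+) h); ed x z (g (+) k); ed y z (h (+) k)].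
have TF0 : T \subset F0 by rewrite !subUset !sub1set exy exz eyz.
have -> : [set ed v x g; ed v y h; ed v z k; ed x y (g (+) h); ed x z (g (+) k);
      ed y z (h (+) k)] = incident F v :|: T by rewrite iE /T !setUA.
have vI : vs (incident F v) = [set v; x; y; z].
  by rewrite iE !vsU !vs1 !ends_ed; apply/setP => t; rewrite !inE; case: (t == v); case: (t == x); case: (t == y); case: (t == z).
have vT : vs (incident F v :|: T) = [set v; x; y; z].
  rewrite vsU vI !vsU !vs1 !ends_ed; apply/setP => t; rewrite !inE.
  by case: (t == v); case: (t == x); case: (t == y); case: (t == z).
have c4 : #|[set v; x; y; z]| = 4.
  by rewrite -!setUA !cardsU1 cards1 !inE !negb_or ![v == _]eq_sym
    (negPf xv) (negPf yv) (negPf zv) xy' xz' yz'.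
have c3 : #|T| = 3.
  rewrite /T -setUA !cardsU1 cards1 !inE negb_or.
  have -> : ed x y (g (+) h) != ed x z (g (+) k).
    by apply/eqP => /ed_inj1[_ /eqP]; rewrite (negPf yz').
  have -> : ed x y (g (+) h) != ed y z (h (+) k).
    by rewrite edC; apply/eqP => /ed_inj1[_ /eqP]; rewrite (negPf xz').
  have -> //: ed x z (g (+) k) != ed y z (h (+) k).
  by rewrite edC (edC y); apply/eqP => /ed_inj1[_ /eqP]; rewrite (negPf xy').
apply: nb; last by rewrite subUset iF (subset_trans TF0).
have cU : #|incident F v :|: T| = 6.
  rewrite cardsU i3 c3; suff -> : incident F v :&: T = set0 by rewrite cards0.
  apply/eqP; rewrite setI_eq0; apply/pred0P => d /=.
  by apply/negP => /andP[dI /(subsetP TF0)]; rewrite in_setD dI.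
apply/and3P; split; first by rewrite -card_gt0 cU.
  (* Normalised to [false] at v, the potential is dictated by the edges at v; the gains of the three
     remaining edges then agree with it. *)
  pose psi := [ffun t => [|| (t == x) && g, (t == y) && h | (t == z) && k]].
  have [Pv Px Py Pz] : [/\ psi v = false, psi x = g, psi y = h & psi z = k].
    rewrite /psi !ffunE !eqxx ![v == _]eq_sym (negPf xv) (negPf yv) (negPf zv).
    rewrite ![y == x]eq_sym ![z == _]eq_sym (negPf xy') (negPf xz') (negPf yz').
    by rewrite !orbF.
  apply/existsP; exists psi; apply/forall_inP => d; rewrite iE !inE.
  rewrite -!orbA => /or4P[|||/or3P[||]] /eqP ->; rewrite potential_ed ?Pv ?Px ?Py ?Pz //.
by rewrite cU vT c4.
Qed.


(** * Contracting a maximal balanced tight set *)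

Section Contraction.
Variables (W : {set V}) (w : V) (psi : {ffun V -> bool}).
Hypotheses (wW : w \in W) (psiW : forall x, x \notin W -> psi x = false).

Definition kap x := if x \in W then w else x.
(** Switching by [psi] comes first, so that collapsing [W] merges vertices in a common gauge. As
    [psi] vanishes off [W], an edge away from [W] is unchanged. *)
Definition contract d := ed (kap d.1.1) (kap d.1.2) (d.2 (+) psi d.1.1 (+) psi d.1.2).

Lemma contract_ed x y g :
  contract (ed x y g) = ed (kap x) (kap y) (g (+) psi x (+) psi y).
Proof. by rewrite /contract; case: (edP x y g) => -> //=; rewrite edC addbAC. Qed.

Lemma kap_in x : (kap x \in W) = (x \in W).
Proof. by rewrite /kap; case: ifP. Qed.

Lemma kap_notin x : x \notin W -> kap x = x.
Proof. by rewrite /kap => /negPf ->. Qed.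

Lemma kap_eq x y : kap x = kap y -> (x \in W) = (y \in W) /\ (x \notin W -> x = y).
Proof.
move=> e; have e' : (x \in W) = (y \in W) by rewrite -kap_in e kap_in.
by split=> // xW; rewrite -(kap_notin xW) e kap_notin // -e'.
Qed.

Variables (F F1 : {set gedge}).
Hypotheses (nF : oriented F) (sF : gsparse F).
Hypotheses (F1F : F1 \proper F) (tF1 : btight F1) (WE : W = vs F1).
Hypothesis pF1 : potential F1 psi.
Hypothesis F1max : forall H, btight H -> H \proper F -> #|H| <= #|F1|.
Hypothesis degF : forall v, v \in vs F -> 2 < #|incident F v|.

Let F2 := F :\: F1.

Let cF1 : #|F1| + 2 = 2 * #|W|.
Proof. by case/and3P: tF1 => _ _ /eqP; rewrite WE. Qed.

Let sF1 : F1 \subset F. Proof. exact: proper_sub. Qed.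

(** Two such edges together with [F1] stay balanced and tight: two edges, one new vertex. By
    maximality they exhaust [F], and then [x] has only two edges, against [degF]. *)
Lemma contract_inj1 x a b g h : x \notin W -> a \in W -> b \in W ->
  ed x a g \in F2 -> ed x b h \in F2 -> g (+) psi a = h (+) psi b ->
  ed x a g = ed x b h.
Proof.
move=> xW aW bW; rewrite !in_setD => /andP[d1 dF] /andP[d1' d'F] gh.
apply/eqP; apply: contraT => ne.
pose H := ed x a g |: (ed x b h |: F1).
have HF : H \subset F by rewrite !subUset !sub1set dF d'F.
have cH : #|H| = #|F1|.+2 by rewrite !cardsU1 in_setU1 negb_or ne d1 d1'.
have vH : vs H = x |: W.
  rewrite !vsU1 !ends_ed -WE; apply/setP => t; rewrite !inE.
  have [->|_] := eqVneq t a; first by rewrite aW !orbT.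
  by have [->|_] := eqVneq t b; rewrite ?bW ?orbT //=; case: (t == x).
have bH : bal H.
  apply/existsP; exists [ffun t => if t == x then g (+) psi a else psi t].
  have nx t : t \in W -> (t == x) = false.
    by move=> tW; apply/eqP => e; rewrite -e tW in xW.
  apply/forall_inP => d; rewrite 2!in_setU1 => /or3P[/eqP->|/eqP->|dF1].
  - by rewrite potential_ed !ffunE eqxx nx // -addbA addbb addbF.
  - by rewrite potential_ed !ffunE eqxx nx // gh -addbA addbb addbF.
  have /subsetP dW : ends d \subset W by rewrite WE; apply: (bigcup_sup d).
  rewrite !ffunE !nx ?dW ?inE ?eqxx ?orbT //.
  exact: (forall_inP pF1).
have tH : btight H.
  apply/and3P; split=> //; first by rewrite -card_gt0 cH.
  by rewrite vH cardsU1 xW cH; move: cF1; clear; lia.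
have HE : H = F.
  apply/eqP; apply: contraT => nHF.
  by have := F1max tH; rewrite properEneq nHF HF cH => /(_ isT); clear; lia.
have xF : x \in vs F by apply/vsP; exists (ed x a g) => //; rewrite ends_ed !inE eqxx.
have := degF xF; rewrite ltnNge => /negP[]; rewrite -HE.
apply: leq_trans (_ : #|[set ed x a g; ed x b h]| <= 2); last by rewrite cards2; case: (_ != _).
apply/subset_leq_card/subsetP => d; rewrite !inE => /andP[/or3P[->|->|dF1]]; rewrite ?orbT //.
move=> xd; case/negP: xW; rewrite WE; apply/vsP; exists d => //.
by rewrite !inE.
Qed.

(** Merged edges agree on which ends lie in [W]. With both ends in [W], two extra edges on [W] break
    even the unbalanced count; with one, [contract_inj1] applies; with none, contraction changes
    nothing. *)
Lemma contract_inj : {in F2 &, injective contract}.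
Proof.
have key i j g i' j' g' : ed i j g \in F2 -> ed i' j' g' \in F2 ->
    contract (ed i j g) = contract (ed i' j' g') -> ed i j g = ed i' j' g'; last first.
  move=> d d' dF2 d'F2; have [dF _] := setDP dF2; have [d'F _] := setDP d'F2.
  have := key d.1.1 d.1.2 d.2 d'.1.1 d'.1.2 d'.2.
  by rewrite (nF dF).1 (nF d'F).1; apply.
move=> dF2 d'F2; have [dF d1] := setDP dF2; have [d'F d1'] := setDP d'F2.
rewrite !contract_ed => /ed_inj[gE kE].
wlog {kE} [ki kj] : i' j' d'F2 d'F d1' gE / kap i = kap i' /\ kap j = kap j'.
  move=> th; case: kE => [e|[e1 e2]]; first exact: th.
  by rewrite [RHS]edC; apply: th; rewrite ?(edC j') // gE addbAC.
have [ei ei'] := kap_eq ki; have [ej ej'] := kap_eq kj.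
have [iW|iW] := boolP (i \in W); have [jW|jW] := boolP (j \in W).
- apply/eqP; apply: contraT => ne.
  pose H := ed i j g |: (ed i' j' g' |: F1).
  have [] := sF (_ : H \subset F); first by rewrite !subUset !sub1set dF d'F.
    by apply/set0Pn; exists (ed i j g); rewrite setU11.
  have -> : vs H = W.
    have sub a b : a \in W -> b \in W -> [set a; b] :|: W = W.
      by move=> aW bW; apply/setUidPr; rewrite subUset !sub1set aW.
    by rewrite !vsU1 !ends_ed -WE !sub // -?ei -?ej.
  by rewrite !cardsU1 in_setU1 negb_or ne d1 d1' => le _; move: cF1 le; clear; lia.
- have jj := ej' jW; rewrite -jj in gE d'F2 *.
  rewrite !(edC _ j) in dF2 d'F2 *; apply: contract_inj1 => //; first by rewrite -ei.
  by move: gE; rewrite (psiW jW) !addbF.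
- have ii := ei' iW; rewrite -ii in gE d'F2 *.
  apply: contract_inj1 => //; first by rewrite -ej.
  by move: gE; rewrite (psiW iW) !addbF.
- rewrite -(ei' iW) -(ej' jW) in gE *; congr ed.
  by move: gE; rewrite (psiW iW) (psiW jW) !addbF.
Qed.

(** An edge inside [W] turning into a loop of trivial gain would fit the potential of [F1], and
    adding it to [F1] would break the balanced count. *)
Lemma contract_normal : oriented (contract @: F2).
Proof.
move=> _ /imsetP[d dF2 ->]; split; first exact: ed_idem.
move/eqP; rewrite /contract ed_loop ed2 => /eqP /kap_eq[e e'].
have [dF1 dF] := setDP dF2.
have [d1W|d1W] := boolP (d.1.1 \in W); last first.
  by rewrite !psiW -?e // !addbF; apply: (nF _).2 => //; apply: e'.
apply: contraT => /negPf g0.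
have [] := sF (_ : d |: F1 \subset F).
- by rewrite subUset sub1set dF1.
- by apply/set0Pn; exists d; rewrite setU11.
rewrite vsU1 -WE /ends cardsU1 dF.
have -> : [set d.1.1; d.1.2] :|: W = W.
  by apply/setUidPr; rewrite subUset !sub1set -e d1W.
move=> _ h; have {h} : #|F1|.+1 + 2 <= 2 * #|W|.
  apply: h; apply/existsP; exists psi; apply/forall_inP => d'.
  rewrite in_setU1 => /orP[/eqP ->|/(forall_inP pF1) //].
  by move: g0; case: d.2; case: (psi _); case: (psi _).
by move: cF1; clear; lia.
Qed.

(** Pull [K] back and add [F1]. If [w] is covered, it is replaced by [W], which adds at most |W| - 1
    vertices, while [F1] adds exactly 2|W| - 2 edges; so both bounds descend to [K]. *)
Lemma contract_gsparse : gsparse (contract @: F2).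
Proof.
move=> K sK K0; pose H := [set d in F2 | contract d \in K].
have HF2 : H \subset F2 by apply/subsetP => d; rewrite inE => /andP[].
have HF : H \subset F := subset_trans HF2 (subsetDl _ _).
have KE : K = contract @: H.
  apply/setP => k; apply/idP/imsetP => [kK|[d]]; last by rewrite inE => /andP[_ ?] ->.
  by have /imsetP[d dF2 kE] := subsetP sK _ kK; exists d; rewrite // inE dF2 -kE.
have cK : #|K| = #|H|.
  by rewrite KE card_in_imset // => d d' /(subsetP HF2) ? /(subsetP HF2) ?; apply: contract_inj.
have [wK|wK] := boolP (w \in vs K); last first.
  have -> : K = H; last first.
    apply: sF => //; move: K0; rewrite -!card_gt0 cK //.
  rewrite KE -[RHS]imset_id; apply: eq_in_imset => d dH.
  have [dE _] := nF (subsetP HF _ dH).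
  have nw z : z \in ends d -> z \notin W.
    move=> zd; apply: contra wK => zW; apply/vsP; exists (contract d).
      by move: dH; rewrite inE => /andP[].
    rewrite /contract ends_ed; move: zd; rewrite !inE /kap.
    by case/orP=> /eqP <-; rewrite zW eqxx ?orbT.
  by rewrite /contract !kap_notin ?psiW ?nw ?inE ?eqxx ?orbT // !addbF.
pose J := H :|: F1.
have JF : J \subset F by rewrite subUset HF.
have J0 : J != set0.
  by rewrite setU_eq0 negb_and -(card_gt0 F1); apply/orP; right; case/and3P: tF1; rewrite card_gt0.
have cJ : #|J| = #|K| + #|F1|.
  rewrite cK cardsU; suff -> : H :&: F1 = set0 by rewrite cards0 subn0.
  apply/eqP; rewrite setI_eq0; apply/pred0P => d /=.
  by apply/negP => /andP[/(subsetP HF2)]; rewrite in_setD => /andP[/negPf ->].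
have vJ : #|vs J| + 1 <= #|W| + #|vs K|.
  have : vs J \subset W :|: (vs K :\ w).
    rewrite vsU -WE subUset subsetUl andbT; apply/subsetP => z /vsP[d dH zd].
    rewrite !inE; have [//|zW /=] := boolP (z \in W).
    apply/andP; split; first by apply: contraNneq zW => ->.
    apply/vsP; exists (contract d); first by move: dH; rewrite inE => /andP[].
    rewrite /contract ends_ed -(kap_notin zW); move: zd; rewrite !inE.
    by case/orP=> /eqP <-; rewrite eqxx ?orbT.
  move=> /subset_leq_card le.
  have c1 : #|vs K| = #|vs K :\ w|.+1 by rewrite (cardsD1 w) wK.
  have c2 := (leq_card_setU W (vs K :\ w)).1.
  by move: le c1 c2; clear; lia.
have [le1 le2] := sF JF J0.
split; first by move: cJ vJ le1 cF1; clear; lia.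
move=> /existsP[chi /forall_inP pchi].
suff bJ : bal J by move: (le2 bJ) cJ vJ cF1; clear; lia.
(* Undoing the switching gives a potential for the preimage of [K]; on [F1] the constant [chi w]
   cancels. *)
apply/existsP; exists [ffun z => chi (kap z) (+) psi z].
apply/forall_inP => d; rewrite in_setU => /orP[dH|dF1].
  move: dH; rewrite inE => /andP[_ /pchi].
  rewrite /contract potential_ed !ffunE; move: (chi _) (chi _) => a b.
  by case: d.2; case: (psi _); case: (psi _); case: a; case: b.
rewrite !ffunE; have /subsetP dW : ends d \subset W by rewrite WE; apply: (bigcup_sup d).
rewrite /kap !dW ?inE ?eqxx ?orbT // addbACA addbb addFb.
exact: (forall_inP pF1).
Qed.

End Contraction.


(** * The induction principle for gain-sparse edge sets *)

Theorem gsparse_ind (P : {set gedge} -> Prop) :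
  P set0 ->
  (forall F v x g, v \notin vs F -> (x = v -> g) -> P F -> P (ed v x g |: F)) ->
  (forall F v x g y h, v \notin vs F -> (x = v -> g) -> (y = v -> h) ->
    (g, x) != (h, y) -> P F -> P (ed v x g |: (ed v y h |: F))) ->
  (forall F v x g y h z k, v \notin vs F -> x != v -> y != v -> z != v ->
    (g, x) != (h, y) -> (g, x) != (k, z) -> (h, y) != (k, z) ->
    ed x y (g (+) h) \notin F -> P (ed x y (g (+) h) |: F) ->
    P (ed v x g |: (ed v y h |: (ed v z k |: F)))) ->
  (forall v x g y h z k, x != v -> y != v -> z != v -> x != y -> x != z -> y != z ->
    P [set ed v x g; ed v y h; ed v z k;
           ed x y (g (+) h); ed x z (g (+) k); ed y z (h (+) k)]) ->
  (forall W w (psi : {ffun V -> bool}) F F1, w \in W -> (forall x, x \notin W -> psi x = false) ->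
    F1 \subset F -> vs F1 \subset W -> potential F1 psi ->
    {in F :\: F1 &, injective (contract W w psi)} ->
    P F1 -> P (contract W w psi @: (F :\: F1)) -> P F) ->
  forall F, oriented F -> gsparse F -> P F.
Proof.
move=> P0 Pext1 Pext2 P1ext PK4 Pcontract F.
have [n] := ubnP #|F|; elim: n F => // n IH F ltFn nF sF.
have [->//|F0] := eqVneq F set0.
have iF v : incident F v \subset F by apply/subsetP => d; rewrite inE => /andP[].
have edv v d : d \in incident F v -> exists x, d = ed v x d.2 /\ (x = v -> d.2).
  by rewrite inE => /andP[dF vd]; apply: normal_ed nF dF vd.
have FE v : F = incident F v :|: (F :\: incident F v).
  by rewrite -{1}(setID F (incident F v)) (setIidPr (iF v)).
have ltF v : v \in vs F -> #|F :\: incident F v| < #|F|.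
  move=> /vsP[d dF vd]; apply: proper_card; rewrite properE subsetDl.
  by apply/subsetPn; exists d; rewrite // in_setD negb_and negbK [d \in incident _ _]inE dF vd.
have [/exists_inP[v vF]|/exists_inPn deg] :=
    boolP [exists v in vs F, #|incident F v| <= 2].
  have vF0 := incident_compl F v.
  have PF0 : P (F :\: incident F v).
    apply: IH; [|exact: normalS (subsetDl _ _) nF|exact: gsparseS (subsetDl _ _) sF].
    exact: leq_trans (ltF _ vF) ltFn.
  rewrite leq_eqVlt => /orP[/cards2P[d1 [d2 [ne iE]]]|].
    have [|x [dx lx]] := edv v d1; first by rewrite iE !inE eqxx.
    have [|y [dy ly]] := edv v d2; first by rewrite iE !inE eqxx orbT.
    rewrite (FE v) {1}iE -setUA dx dy; apply: Pext2 => //.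
    by apply: contra ne => /eqP[e1 e2]; rewrite dx dy e1 e2.
  rewrite ltnS leq_eqVlt => /orP[/cards1P[d1 iE]|].
    have [|x [dx lx]] := edv v d1; first by rewrite iE !inE eqxx.
    by rewrite (FE v) {1}iE dx; apply: Pext1.
  rewrite ltnS leqn0 cards_eq0 => /eqP iE; case/vsP: vF => d dF vd.
  have : d \in incident F v by rewrite inE dF.
  by rewrite iE inE.
have {}deg v : v \in vs F -> 2 < #|incident F v| by move/deg; rewrite -ltnNge.
have [/existsP[H0 H0P]|/existsPn nb] := boolP [exists H, btight H && (H \proper F)].
  (* Maximality, together with all degrees being at least three, is what keeps contraction injective
     on the remaining edges. *)
  case: (@arg_maxnP _ H0 (fun H => btight H && (H \proper F)) (fun H => #|H|) H0P) => F1 /andP[tF1 F1F] F1max.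
  have F10 : 0 < #|F1| by rewrite card_gt0; case/and3P: tF1.
  have [w wW] : exists w, w \in vs F1.
    apply/set0Pn; rewrite -card_gt0; case/and3P: tF1 => _ _ /eqP.
    by clear; lia.
  have [psi0 pF1] : exists psi, potential F1 psi.
    by case/and3P: tF1 => _ /existsP.
  (* Truncated off the vertices of [F1], so that contraction leaves distant edges alone. *)
  pose psi := [ffun x => (x \in vs F1) && psi0 x].
  have psiW x : x \notin vs F1 -> psi x = false by rewrite ffunE => /negPf ->.
  have {}pF1 : potential F1 psi.
    apply/forall_inP => d dF1; rewrite !ffunE.
    have /subsetP dW : ends d \subset vs F1 by apply: (bigcup_sup d).
    by rewrite !dW ?inE ?eqxx ?orbT //; apply: (forall_inP pF1).
  have F1max' H : btight H -> H \proper F -> #|H| <= #|F1|.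
    by move=> tH pH; apply: F1max; rewrite /= tH.
  have inj := contract_inj wW psiW nF sF F1F tF1 erefl pF1 F1max' deg.
  apply: (Pcontract (vs F1) w psi F F1) => //; first exact: proper_sub.
    apply: IH; [|exact: normalS (proper_sub F1F) nF|exact: gsparseS (proper_sub F1F) sF].
    exact: leq_trans (proper_card F1F) ltFn.
  apply: IH.
  - rewrite card_in_imset // cardsD (setIidPr (proper_sub F1F)).
    have pF : #|F1| < #|F| := proper_card F1F.
    rewrite -ltnS; apply: leq_trans ltFn; rewrite ltnS ltn_subrL F10.
    exact: leq_ltn_trans (leq0n _) pF.
  - exact: (contract_normal wW psiW nF sF F1F tF1 erefl pF1).
  exact: (contract_gsparse wW psiW nF sF F1F tF1 erefl pF1 F1max' deg).
have {}nb H : btight H -> H \subset F -> H = F.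
  move=> tH sH; apply/eqP; move: (nb H); rewrite tH properEneq sH andbT /=.
  by rewrite negbK.
have [v vF] := low_degree nF sF F0; have dv := deg v vF.
case=> [|[i3 nl]]; first by rewrite leqNgt dv.
have [d1 d1i] : exists d, d \in incident F v by apply/set0Pn; rewrite -card_gt0 i3.
have /cards2P[d2 [d3 [ne23 iE']]] : #|incident F v :\ d1| == 2.
  by move: i3; rewrite (cardsD1 d1) d1i add1n => -[->].
have iE : incident F v = [set d1; d2; d3] by rewrite -setUA -iE' setD1K.
have : d2 \in incident F v :\ d1 by rewrite iE' !inE eqxx.
rewrite in_setD1 => /andP[ne21 d2i].
have : d3 \in incident F v :\ d1 by rewrite iE' !inE eqxx orbT.
rewrite in_setD1 => /andP[ne31 d3i].
have [x [dx _]] := edv _ _ d1i; have [y [dy _]] := edv _ _ d2i.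
have [z [dz _]] := edv _ _ d3i.
have loopless t d : d \in incident F v -> d = ed v t d.2 -> t != v.
  by move=> di de; have := nl d di; rewrite de ed_loop eq_sym.
have xv := loopless x d1 d1i dx; have yv := loopless y d2 d2i dy.
have zv := loopless z d3 d3i dz.
move: d1.2 d2.2 d3.2 dx dy dz => g h k dx dy dz; subst d1 d2 d3.
have sep a b m m' : ed v a m != ed v b m' -> (m, a) != (m', b).
  by apply: contra => /eqP[-> ->].
have xy : (g, x) != (h, y) by apply: sep; rewrite eq_sym.
have xz : (g, x) != (k, z) by apply: sep; rewrite eq_sym.
have yz : (h, y) != (k, z) by apply: sep.
have prF0 : F :\: incident F v \proper F.
  rewrite properE subsetDl; apply/subsetPn; exists (ed v x g).
    exact: (subsetP (iF v)).
  by rewrite in_setD d1i.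
have vF0 := incident_compl F v.
(* Three edges leave and at most one enters, so the induction hypothesis applies. The roles of the
   neighbours are free, and this one statement serves all three pairs. *)
have ext a m b m' c l : ~ blocked (F :\: incident F v) a b (m (+) m') ->
    a != v -> b != v -> c != v -> (m, a) != (m', b) -> (m, a) != (l, c) ->
    (m', b) != (l, c) -> incident F v = [set ed v a m; ed v b m'; ed v c l] -> P F.
  move=> nbl av bv cv ab ac bc iE2.
  (* Equal neighbours mean parallel edges at v with different gains, so the new loop has gain
     [true]. *)
  have lp : a = b -> m (+) m'.
    by move=> e; move: ab; rewrite e xpair_eqE eqxx andbT; clear; case: m; case: m'.
  have [nG sG] := gsparse_add nF sF prF0 nb lp nbl.
  rewrite (FE v) {1}iE2 -!setUA; apply: P1ext => //.
    by apply/negP => ?; apply: nbl; left.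
  apply: IH => //; rewrite -ltnS; apply: leq_trans ltFn; rewrite ltnS.
  have -> : #|F| = 3 + #|F :\: incident F v|.
    by rewrite -(cardsID (incident F v) F) (setIidPr (iF v)) i3.
  by rewrite cardsU1 -addSn leq_add2r; case: (_ \notin _).
have [bxy|nbl] := EM (blocked (F :\: incident F v) x y (g (+) h)); last first.
  exact: (ext _ _ _ _ z k nbl).
have [bxz|nbl] := EM (blocked (F :\: incident F v) x z (g (+) k)); last first.
  apply: (ext _ _ _ _ y h nbl); rewrite // ?[_ == (h, y)]eq_sym // iE.
  by rewrite -!setUA [[set _] :|: [set ed v z k]]setUC.
have [byz|nbl] := EM (blocked (F :\: incident F v) y z (h (+) k)); last first.
  apply: (ext _ _ _ _ x g nbl); rewrite // ?[_ == (g, x)]eq_sym // iE.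
  by rewrite -!setUA setUC -setUA.
have [? ? ? ->] := all_blocked nF sF iE i3 nb xv yv zv xy xz yz bxy bxz byz.
exact: PK4.
Qed.

End GainSparse.

Local Open Scope ring_scope.

(** * Geometry of the reflection and rows of the orbit matrix *)

Section SignedPower.
Variables (R : realType) (k : R).
Hypothesis k0 : 0 < k.

Definition spow (x : R) : R := Num.sg x * powR `|x| k.

Lemma spow0 : spow 0 = 0. Proof. by rewrite /spow sgr0 mul0r. Qed.

Lemma spow1 : spow 1 = 1.
Proof. by rewrite /spow sgr1 normr1 powR1 mul1r. Qed.

Lemma spowN x : spow (- x) = - spow x.
Proof. by rewrite /spow sgrN normrN mulNr. Qed.

Lemma spowM x y : spow (x * y) = spow x * spow y.
Proof. by rewrite /spow sgrM normrM powRM // mulrACA. Qed.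

Lemma spow_gt0 x : 0 < x -> spow x = powR x k.
Proof. by move=> x0; rewrite /spow gtr0_sg // gtr0_norm // mul1r. Qed.

Lemma sgr_spow x : Num.sg (spow x) = Num.sg x.
Proof.
rewrite /spow sgrM sgr_id; have [->|x0] := eqVneq x 0; first by rewrite sgr0 mul0r.
by rewrite (gtr0_sg (powR_gt0 _ _)) ?mulr1 // normr_gt0.
Qed.

Lemma normr_spow x : `|spow x| = powR `|x| k.
Proof.
have [->|x0] := eqVneq x 0; first by rewrite spow0 normr0 powR0 // gt_eqF.
by rewrite /spow normrM normr_sg x0 mul1r ger0_norm // powR_ge0.
Qed.

Lemma spow_inj : injective spow.
Proof.
move=> x y e; rewrite [LHS]numEsg [RHS]numEsg -(sgr_spow x) -(sgr_spow y) e.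
suff -> : `|x| = `|y| by [].
by apply: (powR_injective k0); rewrite ?nnegrE ?normr_ge0 // -!normr_spow e.
Qed.

Lemma spow_eq0 x : (spow x == 0) = (x == 0).
Proof. by rewrite -{1}spow0 (inj_eq spow_inj). Qed.

(** Positive arguments reduce to [expR (k * ln y)], negative ones follow by oddness, and at zero the
    modulus is |y|^k. *)
Lemma spow_continuous : continuous spow.
Proof.
have pos x : 0 < x -> {for x, continuous spow}.
  move=> x0; rewrite /prop_for /continuous_at spow_gt0 // /powR gt_eqF //.
  have h : {for x, continuous (fun y => expR (k * ln y))}.
    apply: continuous_comp; last exact: continuous_expR.
    by apply: cvgMl_tmp; exact: continuous_ln.
  apply: cvg_trans h; apply: near_eq_cvg; near=> y.
  have y0 : 0 < y by near: y; apply: (cvgr_gt x).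
  by rewrite spow_gt0 // /powR gt_eqF.
move=> x; have [x0|x0|->] := ltgtP x 0.
- have -> : spow = (fun y => - spow (- y)) by apply: funext => y; rewrite spowN opprK.
  apply: cvgN; apply: continuous_comp; first exact: oppr_continuous.
  by apply: pos; rewrite oppr_gt0.
- exact: pos.
rewrite /continuous_at spow0; apply/cvgr0Pnorm_lt => e e0; near=> y.
(* The radius e^(1/k) makes the k-th power smaller than e. *)
rewrite normr_spow; have <- : (e `^ k^-1) `^ k = e.
  by rewrite -powRrM mulVf ?gt_eqF // powRr1 // ltW.
apply: gt0_ltr_powR; rewrite ?nnegrE ?normr_ge0 ?powR_ge0 //.
by near: y; apply: (@nbhs0_lt _ R^o); rewrite powR_gt0.
Unshelve. all: by end_near. Qed.

End SignedPower.

(** * The plane and the reflections that preserve the norm *)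

Section Plane.
Variable R : realType.
Implicit Types (a b x y : 'rV[R]_2).

Lemma dotE a b : dot a b = a 0 0 * b 0 0 + a 0 1 * b 0 1.
Proof.
by rewrite /dot big_ord_recl big_ord_recl big_ord0 addr0; congr (_ + a _ _ * b _ _); apply: val_inj.
Qed.

Lemma row2P a b : a 0 0 = b 0 0 -> a 0 1 = b 0 1 -> a = b.
Proof.
move=> e0 e1; apply/rowP => j; have [->//|j1] : j = 0 \/ j = 1.
  by case: j => -[|[|//]] h; [left | right]; apply: val_inj.
by rewrite j1.
Qed.

Definition pl (u v : R) : 'rV[R]_2 := \row_j (if j == 0 then u else v).

Lemma pl0 u v : pl u v 0 0 = u. Proof. by rewrite mxE. Qed.
Lemma pl1 u v : pl u v 0 1 = v. Proof. by rewrite mxE. Qed.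

Lemma dotDl a b x : dot (a + b) x = dot a x + dot b x.
Proof. by rewrite !dotE !mxE; ring. Qed.
Lemma dotDr a x y : dot a (x + y) = dot a x + dot a y.
Proof. by rewrite !dotE !mxE; ring. Qed.
Lemma dotNr a x : dot a (- x) = - dot a x.
Proof. by rewrite !dotE !mxE; ring. Qed.
Lemma dotNl a x : dot (- a) x = - dot a x.
Proof. by rewrite !dotE !mxE; ring. Qed.
Lemma dotZl c a x : dot (c *: a) x = c * dot a x.
Proof. by rewrite !dotE !mxE; ring. Qed.
Lemma dotZr c a x : dot a (c *: x) = c * dot a x.
Proof. by rewrite !dotE !mxE; ring. Qed.
Lemma dot_comb c d a b x : dot (c *: a + d *: b) x = c * dot a x + d * dot b x.
Proof. by rewrite dotDl !dotZl. Qed.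
Lemma dot0r a : dot a 0 = 0.
Proof. by rewrite !dotE !mxE; ring. Qed.
Lemma dot0l a : dot 0 a = 0.
Proof. by rewrite !dotE !mxE; ring. Qed.

Lemma dotxx_eq0 a : dot a a = 0 -> a = 0.
Proof.
rewrite dotE => h; have := sqr_ge0 (a 0 0); have := sqr_ge0 (a 0 1).
rewrite !expr2 => h1 h0.
have e0 : a 0 0 * a 0 0 = 0 by lra.
have e1 : a 0 1 * a 0 1 = 0 by lra.
apply: row2P; rewrite mxE; apply/eqP.
  by move/eqP: e0; rewrite mulf_eq0 orbb.
by move/eqP: e1; rewrite mulf_eq0 orbb.
Qed.

Definition cross a b : R := a 0 0 * b 0 1 - a 0 1 * b 0 0.

Section Power.
Variable k : R.
Hypothesis k0 : 0 < k.
Local Notation phi := (signed_pow k).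

Lemma phiE a i : phi a 0 i = spow k (a 0 i).
Proof. by rewrite mxE. Qed.

Lemma phiN a : phi (- a) = - phi a.
Proof. by apply/rowP => i; rewrite phiE [RHS]mxE phiE mxE spowN. Qed.

Lemma phiZ c a : phi (c *: a) = spow k c *: phi a.
Proof. by apply/rowP => i; rewrite phiE [RHS]mxE phiE mxE spowM. Qed.

Lemma phi_eq0 a : phi a = 0 -> a = 0.
Proof.
move=> /rowP h; apply/rowP => i; apply/eqP; have := h i.
by rewrite phiE !mxE => /eqP; rewrite spow_eq0.
Qed.

(** The scalar power is multiplicative and injective, so [cross (phi a) (phi b)] vanishes only when
    [cross a b] does: non-parallel gaps have non-parallel weights although [phi] is not linear. *)
Lemma cross_phi a b u v : cross a b != 0 -> u *: phi a + v *: phi b = 0 ->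
  u = 0 /\ v = 0.
Proof.
move=> ab uv.
have c0 : cross (phi a) (phi b) != 0.
  apply: contra ab; rewrite /cross !phiE -!spowM subr_eq0 => /eqP/(spow_inj k0) ->.
  by rewrite subrr.
have cu : u * cross (phi a) (phi b) = 0.
  transitivity (cross (u *: phi a + v *: phi b) (phi b)).
    by rewrite /cross !mxE; ring.
  by rewrite uv /cross !mxE; ring.
have cv : v * cross (phi a) (phi b) = 0.
  transitivity (cross (phi a) (u *: phi a + v *: phi b)).
    by rewrite /cross !mxE; ring.
  by rewrite uv /cross !mxE; ring.
by split; apply/eqP; [move/eqP: cu | move/eqP: cv]; rewrite mulf_eq0 (negPf c0) orbF.
Qed.
End Power.

(* [L] is the linear part of the affine reflection [s]; [n] is normal to its
   mirror and [m] spans the direction of the mirror. *)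
Record axial (k : R) (s L : 'rV[R]_2 -> 'rV[R]_2) (n m : 'rV[R]_2) : Prop := Axial {
  ax_sub : forall x y, s x - s y = L (x - y);
  ax_invol : involutive s;
  ax_lin : forall c x y, L (c *: x + y) = c *: L x + L y;
  ax_dot : forall x y, dot (L x) y = dot x (L y);
  ax_pow : forall x, signed_pow k (L x) = L (signed_pow k x);
  ax_n : L n = - n;
  ax_n0 : n != 0;
  ax_m : L m = m;
  ax_m0 : m != 0;
  ax_fix : forall x, L x = x -> exists c, x = c *: m
}.

(** The linear part has rows (A, B) and (B, -A) with A^2 + B^2 = 1, and the isometry applied to the
    first unit vector gives |A|^q + |B|^q = 1. As q is not 2, one entry vanishes: the mirror is
    parallel to a coordinate axis or to a diagonal, and such a reflection commutes with the signed
    power. *)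
Lemma axial_reflection (q : R) (s : 'rV[R]_2 -> 'rV[R]_2) :
  1 < q -> q != 2 -> is_reflection s -> lq_isometry q s ->
  exists n m, axial (q - 1) s (linear_part s) n m.
Proof.
move=> q1 q2 [c [n [n0 sE]]] iso.
have nn0 : dot n n != 0 by apply: contra n0 => /eqP /dotxx_eq0 ->.
have LE x : linear_part s x = x - (2 * dot x n / dot n n) *: n.
  rewrite /linear_part !sE; apply: row2P; rewrite !mxE.
    by rewrite !dotE !mxE; field; rewrite -dotE.
  by rewrite !dotE !mxE; field; rewrite -dotE.
pose N := dot n n; pose al := n 0 0; pose be := n 0 1.
have NE : N = al ^+ 2 + be ^+ 2 by rewrite /N dotE !expr2.
have N0 : N != 0 by [].
pose A := 1 - 2 * al ^+ 2 / N; pose B := - 2 * al * be / N.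
have AB : A ^+ 2 + B ^+ 2 = 1.
  by rewrite /A /B NE; field; rewrite -NE.
have L0 x : linear_part s x 0 0 = A * x 0 0 + B * x 0 1.
  by rewrite LE !mxE dotE /A /B -/N -/al -/be; field.
have L1 x : linear_part s x 0 1 = B * x 0 0 - A * x 0 1.
  rewrite LE !mxE dotE /A /B -/N -/al -/be.
  have -> : 1 - 2 * al ^+ 2 / N = 2 * be ^+ 2 / N - 1 by rewrite NE; field; rewrite -NE.
  by field.
have AB0 : A = 0 \/ B = 0.
  have : lq_norm q (linear_part s (pl 1 0)) = lq_norm q (pl 1 0).
    by rewrite /linear_part iso subr0.
  have q0 : q != 0 by rewrite gt_eqF // (lt_trans _ q1).
  have nE x : lq_norm q x = powR (powR `|x 0 0| q + powR `|x 0 1| q) q^-1.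
    rewrite /lq_norm big_ord_recl big_ord_recl big_ord0 addr0.
    by congr (powR (_ + powR `|x _ _| _) _); apply: val_inj.
  rewrite !nE L0 L1 pl0 pl1 !mulr1 !mulr0 addr0 subr0 normr1 normr0 powR0 // addr0 !powR1 => h.
  have {}h : powR `|A| q + powR `|B| q = 1.
    have : ((powR `|A| q + powR `|B| q) `^ q^-1) `^ q = 1 by rewrite h powR1.
    rewrite -powRrM mulVf // powRr1 // addr_ge0 // powR_ge0 //.
  have sq (x : R) : powR `|x| q = powR (x ^+ 2) (q / 2).
    by rewrite -real_normK ?num_real // -powR_mulrn // -powRrM mulrCA mulfV ?pnatr_eq0 // mulr1.
  rewrite !sq in h.
  have [A0|A0] := eqVneq A 0; [by left | right].
  apply/eqP; apply: contraT => B0.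
  have a0 : 0 < A ^+ 2 by rewrite exprn_even_gt0.
  have b0 : 0 < B ^+ 2 by rewrite exprn_even_gt0.
  have a1 : A ^+ 2 < 1 by lra.
  have b1 : B ^+ 2 < 1 by lra.
  (* On the open unit interval t^(q/2) lies strictly on one side of t, the same side for both
     squares, so the sum could not stay 1. *)
  have pw (x : R) : 0 < x -> x < 1 -> if q < 2 then x < powR x (q / 2) else powR x (q / 2) < x.
    move=> x0 x1; have lx : ln x < 0 by rewrite ln_lt0 // x0.
    have e r : powR x r = expR (r * ln x) by rewrite /powR gt_eqF.
    have e1 : x = expR (ln x) by rewrite lnK // posrE.
    by rewrite e; case: ltP => h2; [rewrite [ltLHS]e1 | rewrite [ltRHS]e1]; rewrite ltr_expR; nra.
  have := pw _ a0 a1; have := pw _ b0 b1; case: ifP => _; lra.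
have q10 : 0 < q - 1 by rewrite subr_gt0.
(* The mirror direction is the normal turned by a right angle. *)
exists n, (pl (- be) al); split=> //.
- by move=> x y; apply: row2P; rewrite [RHS](L0, L1) !mxE; [have := (L0 x, L0 y) | have := (L1 x, L1 y)];
    rewrite /linear_part !mxE => -[]; lra.
- move=> x; apply: row2P; rewrite !sE !mxE !dotE !mxE; field; by rewrite -dotE.
- move: (linear_part s) {LE} L0 L1 => L L0 L1 u x y.
  by apply: row2P; rewrite (L0, L1) [RHS]mxE [in RHS]mxE !(L0, L1) !mxE; ring.
- by move=> x y; rewrite !dotE !(L0, L1); ring.
- have spZ (c' x : R) : c' ^+ 2 = 1 -> spow (q - 1) (c' * x) = c' * spow (q - 1) x.
    by move/eqP; rewrite sqrf_eq1 => /orP[]/eqP ->; rewrite ?mul1r // !mulN1r spowN.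
  have [e|e] := AB0; move: AB L0 L1; rewrite e expr0n /= ?add0r ?addr0 => ab L0 L1 x.
    by apply: row2P; rewrite !phiE !(L0, L1) !phiE !mul0r ?add0r ?sub0r ?addr0 ?subr0 spZ.
  apply: row2P; rewrite !phiE !(L0, L1) !phiE !mul0r ?add0r ?sub0r ?addr0 ?subr0.
    by rewrite spZ.
  by rewrite spowN spZ.
- apply: row2P; rewrite !(L0, L1) !mxE -/al -/be /A /B NE; field; by rewrite -NE.
- by apply: row2P; rewrite !(L0, L1) !mxE /= /A /B NE; field; rewrite -NE.
- apply: contra n0 => /eqP/rowP h; have := h 0; have := h 1; rewrite !mxE /= => e1 /eqP.
  by rewrite oppr_eq0 => /eqP e0; apply/eqP/row2P; rewrite mxE.
move=> x; rewrite LE => /eqP; rewrite -subr_eq0 addrAC subrr add0r oppr_eq0 scaler_eq0.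
rewrite (negPf n0) orbF mulf_eq0 invr_eq0 (negPf nn0) orbF mulf_eq0 pnatr_eq0 /=.
move/eqP; rewrite dotE -/al -/be => xn.
exists ((al * x 0 1 - be * x 0 0) / N); apply: row2P; rewrite !mxE /=.
  apply: (mulIf N0); rewrite mulrAC divfK // NE.
  have -> : (al * x 0 1 - be * x 0 0) * - be = be ^+ 2 * x 0 0 + al ^+ 2 * x 0 0 - al * (x 0 0 * al + x 0 1 * be) by ring.
  by rewrite xn; ring.
apply: (mulIf N0); rewrite mulrAC divfK // NE.
have -> : (al * x 0 1 - be * x 0 0) * al = be ^+ 2 * x 0 1 + al ^+ 2 * x 0 1 - be * (x 0 0 * al + x 0 1 * be) by ring.
by rewrite xn; ring.
Qed.

End Plane.

Local Opaque ed signed_pow dot.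

(** * Edge rows in gauge form and vertex extensions *)

Section Rows.
Variables (R : realType) (V : finType) (k : R).
Hypothesis k0 : 0 < k.
Variables (s L : 'rV[R]_2 -> 'rV[R]_2) (n m : 'rV[R]_2).
Hypothesis ax : axial k s L n m.

Local Notation plane := 'rV[R]_2.
Local Notation conf := {ffun V -> plane}.
Local Notation phi := (signed_pow k).
Local Notation gact := (Cs_act s).
Implicit Types (p u : conf) (g h : bool) (F : {set gedge V}) (v x y : V).

Definition lact g (a : plane) : plane := if g then L a else a.

Lemma lact_lin g c a b : lact g (c *: a + b) = c *: lact g a + lact g b.
Proof. by case: g => //=; apply: ax_lin ax _ _ _. Qed.

Lemma lactD g a b : lact g (a + b) = lact g a + lact g b.
Proof. by rewrite -(scale1r a) lact_lin !scale1r. Qed.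

Lemma lact0 g : lact g 0 = 0.
Proof. by apply: (addrI (lact g 0)); rewrite -lactD !addr0. Qed.

Lemma lactZ g c a : lact g (c *: a) = c *: lact g a.
Proof. by rewrite -[c *: a]addr0 lact_lin lact0 addr0. Qed.

Lemma lactN g a : lact g (- a) = - lact g a.
Proof. by rewrite -scaleN1r lactZ scaleN1r. Qed.

Lemma lactB g a b : lact g (a - b) = lact g a - lact g b.
Proof. by rewrite lactD lactN. Qed.

Lemma lactK g : involutive (lact g).
Proof.
case: g => //= a; have := ax_sub ax (s a) (s 0); rewrite !(ax_invol ax).
by rewrite (ax_sub ax) !subr0.
Qed.

Lemma lact_addb g h a : lact (g (+) h) a = lact g (lact h a).
Proof. by case: g; case: h => //=; symmetry; apply: (lactK true). Qed.

Lemma dot_lact g a b : dot (lact g a) b = dot a (lact g b).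
Proof. by case: g => //=; apply: ax_dot ax _ _. Qed.

Lemma phi_lact g a : phi (lact g a) = lact g (phi a).
Proof. by case: g => //=; apply: ax_pow ax _. Qed.

Lemma gact_sub g a b : gact g a - gact g b = lact g (a - b).
Proof. by case: g => //=; apply: ax_sub ax _ _. Qed.

Lemma gactK g : involutive (gact g).
Proof. by case: g => //=; apply: ax_invol ax. Qed.

Lemma gact_addb g h a : gact (g (+) h) a = gact g (gact h a).
Proof. by case: g; case: h => //=; rewrite (ax_invol ax). Qed.

Lemma gactD g a b : gact g (a + b) = gact g a + lact g b.
Proof. by rewrite -[LHS](subrK (gact g a)) gact_sub [a + b]addrC addrK addrC. Qed.

Lemma lact_n : lact true n = - n. Proof. exact: ax_n ax. Qed.

(** One edge represents its orbit: that from the identity copy of x to the g-copy of y. Motions are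
    recorded on identity copies only. *)
Definition erow p x y g u : R :=
  dot (phi (p x - gact g (p y))) (u x - lact g (u y)).
Definition rig p (d : gedge V) u : R := erow p d.1.1 d.1.2 d.2 u.

(* Up to the isometry [gact g] the erow only sees the points [gact g (p x)]
   and [gact h (p y)] of the derived framework. *)
Lemma row_gauge p x y g h u : erow p x y (g (+) h) u =
  dot (phi (gact g (p x) - gact h (p y))) (lact g (u x) - lact h (u y)).
Proof.
have -> : gact h (p y) = gact g (gact (g (+) h) (p y)).
  by rewrite -gact_addb addKb.
have -> : lact h (u y) = lact g (lact (g (+) h) (u y)).
  by rewrite -lact_addb addKb.
by rewrite gact_sub -lactB phi_lact dot_lact lactK.
Qed.

Lemma rowC p x y g u : erow p x y g u = erow p y x g u.
Proof.
have := row_gauge p x y g false u; rewrite addbF => ->.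
by rewrite /erow /= -opprB phiN -[lact g _ - _]opprB dotNl dotNr opprK.
Qed.

Lemma rig_ed p x y g u : rig p (ed x y g) u = erow p x y g u.
Proof. by rewrite /rig; case: (edP x y g) => -> //=; rewrite rowC. Qed.

Lemma rig_lin p d c u w : rig p d (c *: u + w) = c * rig p d u + rig p d w.
Proof.
rewrite /rig /erow !ffunE lact_lin -dotZr -dotDr; congr (dot _ _).
by rewrite scalerBr opprD addrACA.
Qed.

(** Phrased for arbitrary forms on configurations, so that it also covers rescaled rows and
    restrictions to a vertex subset. *)
Definition gindep (T : finType) (F : {set T}) (rho : T -> conf -> R) :=
  forall w : T -> R, (forall u, \sum_(d in F) w d * rho d u = 0) ->
  forall d, d \in F -> w d = 0.

Definition indep p F := gindep F (rig p).

Lemma indep0 p : indep p set0.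
Proof. by move=> w _ d; rewrite inE. Qed.

Definition upd p v a : conf := [ffun x => if x == v then a else p x].

Lemma upd_same p v a : upd p v a v = a. Proof. by rewrite ffunE eqxx. Qed.
Lemma upd_diff p v a x : x != v -> upd p v a x = p x.
Proof. by rewrite ffunE => /negPf ->. Qed.

Lemma vsNends F v d : v \notin vs F -> d \in F -> (d.1.1 != v) /\ (d.1.2 != v).
Proof.
move=> vF dF; split; apply: contraNneq vF => <-; apply/vsP; exists d => //.
  by rewrite !inE eqxx.
by rewrite !inE eqxx orbT.
Qed.

Lemma rig_upd p F v a d u : v \notin vs F -> d \in F ->
  rig (upd p v a) d u = rig p d u.
Proof.
by move=> vF dF; have [d1 d2] := vsNends vF dF; rewrite /rig /erow !upd_diff.
Qed.

Lemma indep_upd p F v a : v \notin vs F -> indep p F -> indep (upd p v a) F.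
Proof.
move=> vF ip w h; apply: ip => u; rewrite -[RHS](h u).
by apply: eq_bigr => d dF; rewrite (rig_upd _ _ _ vF).
Qed.

Definition dl v a : conf := upd 0 v a.

Lemma rig_dl p F v a d : v \notin vs F -> d \in F -> rig p d (dl v a) = 0.
Proof.
move=> vF dF; have [d1 d2] := vsNends vF dF.
by rewrite /rig /erow !upd_diff // !ffunE lact0 subr0 dot0r.
Qed.

(** For a loop both ends move; the gap [p v - s (p v)] is reversed by the linear part, so the second
    contribution equals the first, whence the factor 2. *)
Lemma rig_edv p v x g a : (x = v -> g) ->
  rig p (ed v x g) (dl v a) =
  dot ((if x == v then 2 else 1) *: phi (p v - gact g (p x))) a.
Proof.
move=> lx; rewrite rig_ed /erow upd_same; have [e|xv] := eqVneq x v; last first.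
  by rewrite upd_diff // ffunE lact0 subr0 scale1r.
rewrite e upd_same (lx e) dotDr dotNr -dot_lact -phi_lact.
have -> : lact true (p v - gact true (p v)) = - (p v - gact true (p v)).
  by rewrite -gact_sub gactK opprB.
by rewrite phiN dotNl opprK dotZl mulr_natl mulr2n.
Qed.

Lemma ed_notin F v x g : v \notin vs F -> ed v x g \notin F.
Proof.
by apply: contra => h; apply/vsP; exists (ed v x g); rewrite // ends_ed !inE eqxx.
Qed.

Lemma dot_all0 (a : plane) : (forall b, dot a b = 0) -> a = 0.
Proof. by move=> h; apply: dotxx_eq0. Qed.

Lemma sum_rig_dl p F (w : gedge V -> R) v a : v \notin vs F ->
  \sum_(d in F) w d * rig p d (dl v a) = 0.
Proof. by move=> vF; rewrite big1 // => d dF; rewrite (rig_dl _ _ vF dF) mulr0. Qed.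

Lemma coefv_neq0 v x : (if x == v then 2 else 1 : R) != 0.
Proof. by case: ifP; rewrite ?oner_eq0 ?pnatr_eq0. Qed.

Lemma indep_ext1 p F v x g : v \notin vs F -> (x = v -> g) ->
  p v != gact g (p x) -> indep p F -> indep p (ed v x g |: F).
Proof.
move=> vF lx ne ip w h.
have eF := ed_notin x g vF.
have w0 : w (ed v x g) = 0.
  apply/eqP; apply: contraT => wn.
  suff : phi (p v - gact g (p x)) = 0.
    by move/(phi_eq0 k0)/eqP; rewrite subr_eq0 (negPf ne).
  apply: (scalerI (coefv_neq0 v x)); rewrite scaler0; apply: dot_all0 => b.
  rewrite -rig_edv //.
  have := h (dl v b); rewrite big_setU1 //= sum_rig_dl // addr0.
  by move/eqP; rewrite mulf_eq0 (negPf wn) => /eqP.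
move=> d; rewrite in_setU1 => /orP[/eqP -> //|]; apply: ip => u.
by have := h u; rewrite big_setU1 //= w0 mul0r add0r.
Qed.

Lemma indep_ext2 p F v x g y h : v \notin vs F -> (x = v -> g) -> (y = v -> h) ->
  (g, x) != (h, y) ->
  cross (p v - gact g (p x)) (p v - gact h (p y)) != 0 ->
  indep p F -> indep p (ed v x g |: (ed v y h |: F)).
Proof.
move=> vF lx ly ne cr ip w hw.
have eF := ed_notin x g vF; have fF := ed_notin y h vF.
have ef : ed v x g \notin ed v y h |: F.
  by rewrite in_setU1 negb_or eF andbT; apply: contra ne => /eqP/ed_inj1 ->.
have [w1 w2] : w (ed v x g) = 0 /\ w (ed v y h) = 0.
  have := @cross_phi _ k k0 _ _ (w (ed v x g) * (if x == v then 2 else 1))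
    (w (ed v y h) * (if y == v then 2 else 1)) cr.
  case.
    apply: dot_all0 => b; have E1 := rig_edv p b lx; have E2 := rig_edv p b ly.
    rewrite dotZl in E1; rewrite dotZl in E2.
    have E := hw (dl v b); rewrite (big_setU1 _ ef) (big_setU1 _ fF) /= in E.
    by rewrite sum_rig_dl // addr0 E1 E2 !mulrA in E; rewrite dot_comb.
  move=> /eqP; rewrite mulf_eq0 (negPf (coefv_neq0 v x)) orbF => /eqP ->.
  by move=> /eqP; rewrite mulf_eq0 (negPf (coefv_neq0 v y)) orbF => /eqP ->.
move=> d; rewrite !in_setU1 => /or3P[/eqP -> //|/eqP -> //|]; apply: ip => u.
by have := hw u; rewrite !big_setU1 //= w1 w2 !mul0r !add0r.
Qed.

(** With v at the midpoint of two neighbour images, the gaps to them are opposite halves of [D], and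
    homogeneity makes both weights multiples of [phi D]. Moving v alone forces equal coefficients on
    these two edges and zero on the third; the two rows then combine to a multiple of the row of the
    removed edge. *)
Lemma indep_1ext p F v x g y h z l : v \notin vs F ->
  x != v -> y != v -> z != v ->
  (g, x) != (h, y) -> (g, x) != (l, z) -> (h, y) != (l, z) ->
  ed x y (g (+) h) \notin F ->
  cross (gact h (p y) - gact g (p x)) (gact l (p z) - gact g (p x)) != 0 ->
  indep p (ed x y (g (+) h) |: F) ->
  indep (upd p v (2^-1 *: (gact g (p x) + gact h (p y))))
    (ed v x g |: (ed v y h |: (ed v z l |: F))).
Proof.
move=> vF xv yv zv xy xz yz fF cr ip w.
move Ep: (upd _ _ _) => p' hw.
pose f := ed x y (g (+) h).
have sep a b i j : (i, a) != (j, b) -> ed v a i != ed v b j.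
  by apply: contra => /eqP/ed_inj1 ->.
have e3 : ed v z l \notin F := ed_notin z l vF.
have e2 : ed v y h \notin ed v z l |: F by rewrite in_setU1 negb_or sep // ed_notin.
have e1 : ed v x g \notin ed v y h |: (ed v z l |: F).
  by rewrite !in_setU1 !negb_or !sep //= ed_notin.
have hw' u : w (ed v x g) * rig p' (ed v x g) u + (w (ed v y h) * rig p' (ed v y h) u +
   (w (ed v z l) * rig p' (ed v z l) u + \sum_(d in F) w d * rig p d u)) = 0.
  have hS : \sum_(d in F) w d * rig p' d u = \sum_(d in F) w d * rig p d u.
    by apply: eq_bigr => d dF; rewrite -Ep (rig_upd _ _ _ vF).
  have E := hw u.
  rewrite (big_setU1 _ e1) (big_setU1 _ e2) (big_setU1 _ e3) /= hS in E.
  exact: E.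
pose D := gact h (p y) - gact g (p x).
pose c := spow k 2^-1.
have c0 : c != 0 by rewrite (spow_eq0 k0) invr_eq0 pnatr_eq0.
have half (a b : plane) : 2^-1 *: (a + b) - a = 2^-1 *: (b - a).
  by apply: row2P; rewrite !mxE; field.
have pD : phi (2^-1 *: D) = c *: phi D by apply: phiZ.
have p1 : p' v - gact g (p' x) = 2^-1 *: D by rewrite -Ep upd_same upd_diff // half.
have p2 : p' v - gact h (p' y) = - (2^-1 *: D).
  by rewrite -Ep upd_same upd_diff // [gact g (p x) + _]addrC half -scalerN opprB.
have p3 : p' v - gact l (p' z) =
    2^-1 *: D - (gact l (p z) - gact g (p x)).
  by rewrite -Ep upd_same upd_diff // -half opprB addrA subrK.
have [w12 w3] : (w (ed v x g) - w (ed v y h)) * c = 0 /\ w (ed v z l) = 0.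
  apply: (@cross_phi _ k k0 D (p' v - gact l (p' z))).
    apply: contra cr => /eqP e; apply/eqP; rewrite -[RHS]oppr0 -[in RHS]e p3 /cross !mxE.
    by ring.
  apply: dot_all0 => b; have E := hw' (dl v b); rewrite sum_rig_dl // addr0 in E.
  have nv t i : t != v -> t = v -> i by move=> tv e; rewrite e eqxx in tv.
  have E1 := rig_edv p' b (nv x g xv); have E2 := rig_edv p' b (nv y h yv).
  have E3 := rig_edv p' b (nv z l zv).
  rewrite (negPf xv) scale1r p1 pD dotZl in E1.
  rewrite (negPf yv) scale1r p2 phiN pD dotNl dotZl in E2.
  rewrite (negPf zv) scale1r in E3.
  rewrite E1 E2 E3 in E; rewrite dot_comb.
  move: (dot (phi D) b) (dot (phi (p' v - _)) b) (w _) (w _) (w _) E => X Y w1 w2 w3.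
  by move=> <-; ring.
have w12' : w (ed v x g) = w (ed v y h).
  by apply/eqP; rewrite -subr_eq0; move/eqP: w12; rewrite mulf_eq0 (negPf c0) orbF.
(* The common coefficient, scaled by [spow k 2^-1], becomes that of the removed edge. *)
pose w' d := if d == f then w (ed v x g) * c else w d.
have h' u : \sum_(d in f |: F) w' d * rig p d u = 0.
  have R1 : rig p' (ed v x g) u = c * dot (phi D) (u v - lact g (u x)).
    by rewrite rig_ed /erow p1 pD dotZl.
  have R2 : rig p' (ed v y h) u = - (c * dot (phi D) (u v - lact h (u y))).
    by rewrite rig_ed /erow p2 phiN pD dotNl dotZl.
  have R3 : rig p f u = dot (phi D) (lact h (u y) - lact g (u x)).
    by rewrite rig_ed row_gauge -opprB phiN dotNl -dotNr opprB.
  have S : \sum_(d in F) w' d * rig p d u = \sum_(d in F) w d * rig p d u.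
    apply: eq_bigr => d dF; rewrite /w'; case: eqP => // e.
    by move: fF; rewrite -/f -e dF.
  have E := hw' u; rewrite R1 R2 w3 -w12' in E.
  rewrite (big_setU1 _ fF) /= S /w' eqxx R3.
  rewrite !(dotDr, dotNr) in E *.
  move: (\sum_(d in F) _) (dot _ _) (dot _ _) (dot _ _) (w _) (rig _ _ _) E => S' X Y Z w1 r E.
  by rewrite -[RHS]E; ring.
have w0 d : d \in f |: F -> w' d = 0 by apply: ip.
have wx : w (ed v x g) = 0.
  have := w0 f (setU11 _ _); rewrite /w' eqxx => /eqP.
  by rewrite mulf_eq0 (negPf c0) orbF => /eqP.
move=> d; rewrite !in_setU1 => /or4P[/eqP->|/eqP->|/eqP->|dF] //; first by rewrite -w12'.
have := w0 d; rewrite in_setU1 dF orbT => /(_ isT); rewrite /w'.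
by case: eqP => // e; move: fF; rewrite -/f -e dF.
Qed.

End Rows.

(** * Stability of linear independence *)

Section Openness.
Variables (R : realType) (V : finType).
Local Notation plane := 'rV[R]_2.
Local Notation conf := {ffun V -> plane}.
Implicit Types (I : finType).

Lemma continuous_sum I (f : I -> R -> R) a :
  (forall i, {for a, continuous (f i)}) ->
  {for a, continuous (fun t => \sum_i f i t)}.
Proof. by move=> h; apply: (cvg_big (@pseudometric_normed_Zmodule.add_continuous R R^o)) => i _; apply: h. Qed.

Lemma continuous_prod I (f : I -> R -> R) a :
  (forall i, {for a, continuous (f i)}) ->
  {for a, continuous (fun t => \prod_i f i t)}.
Proof. by move=> h; apply: (cvg_big (@mul_continuous R)) => i _; apply: h. Qed.

Lemma continuous_det j (M : R -> 'M[R]_j) a :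
  (forall i l, {for a, continuous (fun t => M t i l)}) ->
  {for a, continuous (fun t => \det (M t))}.
Proof.
move=> h; apply: continuous_sum => p; apply: cvgMl_tmp.
by apply: continuous_prod => i; apply: h.
Qed.

Definition bas (j : V * 'I_2) : conf :=
  [ffun x => if x == j.1 then delta_mx 0 j.2 else 0].

Lemma conf_bas (u : conf) : u = \sum_j u j.1 0 j.2 *: bas j.
Proof.
apply/ffunP => x; rewrite sum_ffunE; apply/rowP => i.
rewrite summxE (bigD1 (x, i)) //= big1 ?addr0 => [|[y l] ne].
  by rewrite !ffunE eqxx !mxE !eqxx mulr1.
rewrite !ffunE; case: eqP => [xy|_]; last by rewrite scaler0 mxE.
rewrite !mxE eqxx /=; case: eqP => [il|_]; last by rewrite mulr0.
by rewrite xy il eqxx in ne.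
Qed.

Section Dual.
Variables (T : finType) (F : {set T}).

(** Independent forms have a matrix of full row rank in the standard basis; the columns of a right
    inverse are the dual vectors. *)
Lemma gindep_dual (rho : T -> conf -> R) :
  (forall d c u w, rho d (c *: u + w) = c * rho d u + rho d w) ->
  gindep F rho ->
  exists e : T -> conf, forall d d', d \in F -> d' \in F -> rho d (e d') = (d == d')%:R.
Proof.
move=> lin ind.
have rho0 d : rho d 0 = 0.
  by have := lin d 1 0 0; rewrite scale1r addr0 mul1r; lra.
have rho_sum d (I : finType) (c : I -> R) (v : I -> conf) :
    rho d (\sum_i c i *: v i) = \sum_i c i * rho d (v i).
  by elim/big_rec2: _ => [//|i y x _ <-]; rewrite lin.
pose A := \matrix_(i < #|F|, j < #|{: V * 'I_2}|) rho (enum_val i) (bas (enum_val j)).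
have A0 : row_free A.
  apply: inj_row_free => x xA; apply/rowP => i; rewrite mxE.
  pose w d := if [pick i : 'I_#|F| | enum_val i == d] is Some i then x 0 i else 0.
  have wE (l : 'I_#|F|) : w (enum_val l) = x 0 l.
    by rewrite /w; case: pickP => [l' /eqP/enum_val_inj -> //|/(_ l)]; rewrite eqxx.
  rewrite -wE; apply: (ind w _ _ (enum_valP i)) => u.
  rewrite big_enum_val (conf_bas u).
  under eq_bigr do rewrite wE rho_sum mulr_sumr.
  rewrite exchange_big big1 //= => j _.
  have /rowP/(_ (enum_rank j)) := xA; rewrite !mxE => e.
  transitivity (u j.1 0 j.2 * \sum_i x 0 i * A i (enum_rank j)); last by rewrite e mulr0.
  by rewrite mulr_sumr; apply: eq_bigr => l _; rewrite mxE enum_rankK mulrCA.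
have /row_freeP[B AB] := A0.
pose e' (i : 'I_#|F|) : conf := \sum_j B j i *: bas (enum_val j).
exists (fun d => if [pick i : 'I_#|F| | enum_val i == d] is Some i then e' i else 0).
move=> d d' dF d'F; case: pickP => [i /eqP <-|/(_ (enum_rank_in d'F d'))]; last first.
  by rewrite enum_rankK_in ?eqxx.
have [i0 ->] : exists i0 : 'I_#|F|, d = enum_val i0.
  by exists (enum_rank_in dF d); rewrite enum_rankK_in.
rewrite (inj_eq enum_val_inj) rho_sum.
have /matrixP/(_ i0 i) := AB; rewrite !mxE => <-.
by under [RHS]eq_bigr do rewrite mxE mulrC.
Qed.

(** Test the forms on the dual vectors for t = 0. The resulting square matrix is the identity at 0
    and its determinant is continuous; where it is nonzero, no nontrivial relation survives. *)
Lemma gindep_near (rho : R -> T -> conf -> R) :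
  (forall t d c u w, rho t d (c *: u + w) = c * rho t d u + rho t d w) ->
  (forall d u, d \in F -> {for 0, continuous (fun t => rho t d u)}) ->
  gindep F (rho 0) -> \forall t \near (0 : R), gindep F (rho t).
Proof.
move=> lin ct ind; have [e eP] := gindep_dual (lin 0) ind.
pose N t := \matrix_(i < #|F|, j < #|F|) rho t (enum_val i) (e (enum_val j)).
have cdet : {for 0, continuous (fun t => \det (N t))}.
  apply: continuous_det => i l.
  have -> : (fun t => N t i l) = (fun t => rho t (enum_val i) (e (enum_val l))).
    by apply: funext => t; rewrite mxE.
  by apply: ct; apply: enum_valP.
have N0 : N 0 = 1%:M.
  by apply/matrixP => i j; rewrite !mxE eP ?enum_valP // (inj_eq enum_val_inj).
have : \forall t \near (0 : R), \det (N t) != 0.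
  by apply: cvgr_neq0 cdet _; rewrite N0 det1 oner_eq0.
apply: filterS => t dt w wt d dF.
have uN : N t \in unitmx by rewrite unitmxE unitfE.
pose x := \row_(i < #|F|) w (enum_val i).
have xN : x *m N t = 0.
  apply/rowP => j; rewrite !mxE -[RHS](wt (e (enum_val j))) [RHS]big_enum_val.
  by apply: eq_bigr => i _; rewrite !mxE.
have x0 : x = 0 by rewrite -(mulmxK uN x) xN mul0mx.
have /rowP/(_ (enum_rank_in dF d)) := x0.
by rewrite !mxE enum_rankK_in.
Qed.

(* Rank-nullity for a finite family of linear forms. *)
Lemma kernel_dim (rho : T -> conf -> R) :
  (forall d c u w, rho d (c *: u + w) = c * rho d u + rho d w) ->
  exists K : {vspace conf}, [/\ forall u, u \in K <-> (forall d, d \in F -> rho d u = 0),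
    (2 * #|V| <= \dim K + #|F|)%N &
    gindep F rho -> (\dim K + #|F| = 2 * #|V|)%N].
Proof.
move=> lin.
pose f (u : conf) : 'rV[R]_#|F| := \row_i rho (enum_val i) u.
have flin : linear f by move=> c u w; apply/rowP => i; rewrite !mxE lin.
pose fL : {linear conf -> 'rV[R]_#|F|} := HB.pack f (GRing.isLinear.Build _ _ _ _ f flin).
pose h := linfun fL.
have hE u : h u = f u by rewrite lfunE.
have dV : \dim {: conf} = (2 * #|V|)%N.
  have dE : dim conf = (#|V| * dim plane)%N by [].
  by rewrite dimvf dE dim_matrix mulnC.
have rk := limg_ker_dim h fullv; rewrite capfv dV in rk.
have dR : \dim {: 'rV[R]_#|F|} = #|F| by rewrite dimvf dim_matrix; apply: mul1n.
exists (lker h); split.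
- move=> u; rewrite memv_ker hE; split=> [/eqP/rowP fu d dF|h0].
    by have := fu (enum_rank_in dF d); rewrite !mxE enum_rankK_in.
  by apply/eqP/rowP => i; rewrite !mxE h0 // enum_valP.
- by rewrite -rk leq_add2l -[X in (_ <= X)%N]dR dimvS // subvf.
move=> ind; have [e eP] := gindep_dual lin ind.
rewrite -rk; congr (_ + _)%N; rewrite -[LHS]dR; congr (\dim _).
apply/eqP; rewrite eqEsubv subvf andbT; apply/subvP => y _.
have -> : y = \sum_i y 0 i *: h (e (enum_val i)).
  apply/rowP => j; rewrite summxE (bigD1 j) //= hE !mxE eP ?enum_valP // eqxx mulr1.
  rewrite big1 ?addr0 // => i ij; rewrite hE !mxE eP ?enum_valP //.
  by rewrite (inj_eq enum_val_inj) eq_sym (negPf ij) mulr0.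
by apply: memv_suml => i _; rewrite memvZ // memv_img // memvf.
Qed.

End Dual.

End Openness.

(** * Generic independence of gain-sparse edge sets *)

Section Existence.
Variables (R : realType) (V : finType) (k : R).
Hypothesis k0 : 0 < k.
Variables (s L : 'rV[R]_2 -> 'rV[R]_2) (n m : 'rV[R]_2).
Hypothesis ax : axial k s L n m.

Local Notation plane := 'rV[R]_2.
Local Notation conf := {ffun V -> plane}.
Local Notation phi := (signed_pow k).
Local Notation gact := (Cs_act s).
Local Notation lact := (lact L).
Local Notation rigf := (rig k s L).
Local Notation rowf := (erow k s L).
Local Notation indp := (indep k s L).
Implicit Types (p u : conf) (g h l : bool) (F : {set gedge V}) (v x y : V).
Implicit Types (a b c : plane) (t : R).

Lemma dot_phi_continuous a b c :
  {for 0, continuous (fun t => dot (phi (a + t *: b)) c)}.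
Proof.
have -> : (fun t => dot (phi (a + t *: b)) c) =
    (fun t => spow k (a 0 0 + t * b 0 0) * c 0 0 + spow k (a 0 1 + t * b 0 1) * c 0 1).
  by apply: funext => t; rewrite dotE !phiE !mxE.
have ct (i : 'I_2) : {for (0 : R), continuous (fun t => spow k (a 0 i + t * b 0 i) * c 0 i)}.
  apply: cvgMr_tmp.
  apply: (@continuous_comp _ _ _ (fun t => a 0 i + t * b 0 i) (spow k)); last exact: spow_continuous.
  by apply: cvgD; [exact: cvg_cst | apply: cvgMr_tmp; exact: cvg_id].
by apply: cvgD; apply: ct.
Qed.

Lemma path_gap (p w : conf) t x y g :
  (p + t *: w) x - gact g ((p + t *: w) y) =
  (p x - gact g (p y)) + t *: (w x - lact g (w y)).
Proof.
rewrite !ffunE (gactD ax) (lactZ ax) scalerBr opprD.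
by rewrite addrACA.
Qed.

Lemma rig_path_continuous (p w : conf) d u :
  {for 0, continuous (fun t => rigf (p + t *: w) d u)}.
Proof.
have -> : (fun t => rigf (p + t *: w) d u) = (fun t =>
    dot (phi ((p d.1.1 - gact d.2 (p d.1.2)) + t *: (w d.1.1 - lact d.2 (w d.1.2))))
      (u d.1.1 - lact d.2 (u d.1.2))).
  by apply: funext => t; rewrite /rig /erow path_gap.
exact: dot_phi_continuous.
Qed.

(** Twice the signed area of a triangle of derived points; the pair (g, x) names the point
    [gact g (p x)]. *)
Definition tri p (z1 z2 z3 : bool * V) : R :=
  cross (gact z1.1 (p z1.2) - gact z2.1 (p z2.2))
    (gact z1.1 (p z1.2) - gact z3.1 (p z3.2)).

Lemma tri_rot p (z1 z2 z3 : bool * V) : tri p z1 z2 z3 = tri p z2 z3 z1.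
Proof.
rewrite /tri /cross !mxE.
move: (gact _ _) (gact _ _) (gact _ _) => a b c; ring.
Qed.

(** A polynomial of degree at most two vanishing at e/2, e/3 and e/4 is zero, but its value at 1 is
    A + B + C. *)
Lemma quadratic_near (A B C e : R) : 0 < e -> A + B + C != 0 ->
  exists2 t, 0 < t < e & A + t * B + t ^+ 2 * C != 0.
Proof.
move=> e0 ABC.
have [|h2] := eqVneq (A + (e / 2) * B + (e / 2) ^+ 2 * C) 0; last first.
  by exists (e / 2) => //; lra.
have [|h3] := eqVneq (A + (e / 3) * B + (e / 3) ^+ 2 * C) 0; last first.
  by exists (e / 3) => //; lra.
have [|h4] := eqVneq (A + (e / 4) * B + (e / 4) ^+ 2 * C) 0; last first.
  by exists (e / 4) => //; lra.
rewrite !expr2 => h4 h3 h2; exfalso.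
have eB : e * B = 0 by lra.
have eC : e * (e * C) = 0 by lra.
have A0 : A = 0 by lra.
have e00 : e != 0 by rewrite gt_eqF.
have B0 : B = 0 by apply/eqP; move/eqP: eB; rewrite mulf_eq0 (negPf e00).
have C0 : C = 0 by apply/eqP; move/eqP: eC; rewrite !mulf_eq0 (negPf e00).
by move/eqP: ABC; apply; rewrite A0 B0 C0 !addr0.
Qed.

(** Move along the segment towards [p1]. Independence persists for small t, while [tri] is quadratic
    in t and nonzero at t = 1, hence nonzero at arbitrarily small t. *)
Lemma perturb p p1 F (z1 z2 z3 : bool * V) : indp p F -> tri p1 z1 z2 z3 != 0 ->
  exists2 p', indp p' F & tri p' z1 z2 z3 != 0.
Proof.
move=> ip tr1; pose w := p1 - p; pose P t := p + t *: w.
have /nbhs_norm0P[e /= e0 he] : \forall t \near (0 : R), indp (P t) F.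
  apply: (@gindep_near _ _ _ F (fun t => rigf (P t))).
  - by move=> t d c u u'; rewrite (rig_lin ax).
  - by move=> d u _; apply: rig_path_continuous.
  by rewrite /P scale0r addr0.
pose D (z : bool * V) := gact z.1 (p z.2); pose D1 (z : bool * V) := gact z.1 (p1 z.2).
have der t (z : bool * V) : gact z.1 (P t z.2) = D z + t *: (D1 z - D z).
  by rewrite /P !ffunE (gactD ax) (lactZ ax) -(gact_sub ax).
pose dz z := D1 z - D z.
pose A := cross (D z1 - D z2) (D z1 - D z3).
pose B := cross (D z1 - D z2) (dz z1 - dz z3) + cross (dz z1 - dz z2) (D z1 - D z3).
pose C := cross (dz z1 - dz z2) (dz z1 - dz z3).
have triE t : tri (P t) z1 z2 z3 = A + t * B + t ^+ 2 * C.
  rewrite /tri !der /A /B /C /dz /cross !mxE.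
  by move: (D z1) (D z2) (D z3) (D1 z1) (D1 z2) (D1 z3) => a1 a2 a3 b1 b2 b3; ring.
have P1 : P 1 = p1 by rewrite /P scale1r /w addrC subrK.
have ABC : A + B + C != 0 by move: tr1; rewrite -P1 triE mul1r expr1n mul1r.
have [t /andP[t0 te] tn] := quadratic_near e0 ABC.
exists (P t); last by rewrite triE.
by apply: he; rewrite /= gtr0_norm.
Qed.

Lemma nonfixed : exists a, s a != a.
Proof.
have [s0|s0] := eqVneq (s 0) 0; last by exists 0.
exists n; have := ax_sub ax n 0; rewrite s0 !subr0 (ax_n ax) => ->.
apply: contra (ax_n0 ax) => /eqP e; apply/eqP/row2P; rewrite mxE.
  by have := congr1 (fun c : plane => c 0 0) e; rewrite !mxE; lra.
by have := congr1 (fun c : plane => c 0 1) e; rewrite !mxE; lra.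
Qed.

Lemma tri_ex_fiber x g h (z : bool * V) : g != h -> z.2 != x ->
  exists p, tri p (g, x) (h, x) z != 0.
Proof.
move=> gh zx; have [a sa] := nonfixed.
have e0 : gact g a - gact h a != 0.
  by rewrite subr_eq0; case: g gh; case: h => //= _; rewrite eq_sym.
pose e := gact g a - gact h a.
(* As [a] avoids the mirror, the two copies of x differ by [e] up to sign; the third point is offset
   from the first at a right angle to [e]. *)
exists [ffun y => if y == x then a else gact z.1 (gact g a - pl (- e 0 1) (e 0 0))].
rewrite /tri !ffunE /= eqxx (negPf zx) (gactK ax) -/e opprB addrC subrK.
rewrite /cross pl0 pl1; apply: contra e0 => /eqP h0.
by apply/eqP/dotxx_eq0; rewrite dotE -[RHS]h0; ring.
Qed.

(** Three distinct derived vertices cannot lie in one orbit of a group of order two. If two share an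
    orbit, [tri_ex_fiber] applies after a cyclic shift; otherwise the three points can be chosen
    freely. *)
Lemma tri_ex (z1 z2 z3 : bool * V) : z1 != z2 -> z1 != z3 -> z2 != z3 ->
  exists p, tri p z1 z2 z3 != 0.
Proof.
case: z1 z2 z3 => [g x] [h y] [l z]; rewrite !xpair_eqE !negb_and.
have ff (i j : bool) (c e : V) : (i != j) || (c != e) -> c = e -> i != j.
  by move=> /orP[//|/negPf ce /eqP]; rewrite ce.
have b3 (i j k' : bool) : i != j -> i != k' -> j != k' -> False.
  by case: i; case: j; case: k'.
move=> h12 h13 h23.
have [exy|xy] := eqVneq x y.
  have gh := ff _ _ _ _ h12 exy; rewrite -exy in h23 *.
  have zx : z != x.
    apply/eqP => e; rewrite e in h13 h23.
    by apply: (b3 g h l) => //; [apply: (ff _ _ x x) | apply: (ff _ _ x x)].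
  exact: (@tri_ex_fiber x g h (l, z)).
have [eyz|yz] := eqVneq y z.
  have hl := ff _ _ _ _ h23 eyz; rewrite -eyz.
  have [p hp] := @tri_ex_fiber y h l (g, x) hl xy.
  by exists p; rewrite tri_rot.
have [exz|xz] := eqVneq x z.
  have gl := ff _ _ _ _ h13 exz; rewrite -exz.
  rewrite eq_sym in gl; rewrite eq_sym in xy.
  have [p hp] := @tri_ex_fiber x l g (h, y) gl xy.
  by exists p; rewrite -tri_rot.
exists [ffun t => if t == x then gact g 0 else if t == y then gact h (pl 1 0)
  else gact l (pl 0 1)].
rewrite /tri !ffunE /= !eqxx ![_ == x]eq_sym [z == y]eq_sym.
rewrite (negPf xy) (negPf xz) (negPf yz) !(gactK ax).
by rewrite /cross !mxE /= !(sub0r, mulr0, mul0r, oppr0, subr0) mulrNN mulr1 oner_eq0.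
Qed.

Lemma ext1_ex F v x g : v \notin vs F -> (x = v -> g) ->
  (exists p, indp p F) -> exists p, indp p (ed v x g |: F).
Proof.
move=> vF lx [p ip].
have [e|xv] := eqVneq x v.
  have [a sa] := nonfixed; exists (upd p v a).
  apply: (indep_ext1 k0 ax vF lx); last exact: (indep_upd vF ip).
  by rewrite e upd_same (lx e) eq_sym.
exists (upd p v (gact g (p x) + n)).
apply: (indep_ext1 k0 ax vF lx); last exact: (indep_upd vF ip).
by rewrite upd_same upd_diff // -subr_eq0 addrC addKr (ax_n0 ax).
Qed.

Lemma ext2_ex F v x g y h : v \notin vs F -> (x = v -> g) -> (y = v -> h) ->
  (g, x) != (h, y) ->
  (exists p, indp p F) -> exists p, indp p (ed v x g |: (ed v y h |: F)).
Proof.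
move=> vF lx ly ne [p ip].
(* The identity copy of v differs from all its neighbours, as a loop leads to the other copy. *)
have nv (i : bool) (t : V) : (t = v -> i) -> (false, v) != (i, t).
  by move=> lt; apply/eqP => -[e1 e2]; move: lt; rewrite e2 -e1 => /(_ erefl).
have [p1 tr] := tri_ex (nv _ _ lx) (nv _ _ ly) ne.
have [p' ip' tr'] := perturb ip tr.
by exists p'; apply: (indep_ext2 k0 ax vF lx ly ne tr' ip').
Qed.

Lemma ext3_ex F v x g y h z l : v \notin vs F ->
  x != v -> y != v -> z != v ->
  (g, x) != (h, y) -> (g, x) != (l, z) -> (h, y) != (l, z) ->
  ed x y (g (+) h) \notin F ->
  (exists p, indp p (ed x y (g (+) h) |: F)) ->
  exists p, indp p (ed v x g |: (ed v y h |: (ed v z l |: F))).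
Proof.
move=> vF xv yv zv xy xz yz fF [p ip].
have [p1 tr] := tri_ex xy xz yz.
have [p' ip' tr'] := perturb ip tr.
exists (upd p' v (2^-1 *: (gact g (p' x) + gact h (p' y)))).
apply: (indep_1ext k0 ax vF xv yv zv xy xz yz fF _ ip').
apply: contra tr' => /eqP e; apply/eqP; rewrite -[RHS]e /tri /cross !mxE /=.
move: (gact _ _) (gact _ _) (gact _ _) => a b c; ring.
Qed.

End Existence.

(** * Placements of [K_4] and of blown-up contractions *)

Section Core.
Variables (R : realType) (V : finType) (k : R).
Hypothesis k0 : 0 < k.
Variables (s L : 'rV[R]_2 -> 'rV[R]_2) (n m : 'rV[R]_2).
Hypothesis ax : axial k s L n m.

Local Notation plane := 'rV[R]_2.
Local Notation conf := {ffun V -> plane}.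
Local Notation phi := (signed_pow k).
Local Notation gact := (Cs_act s).
Local Notation lact := (lact L).
Local Notation rigf := (rig k s L).
Local Notation rowf := (erow k s L).
Local Notation indp := (indep k s L).
Implicit Types (p u : conf) (g h l : bool) (F : {set gedge V}) (v x y : V).
Implicit Types (a b c : plane).

Lemma spow_half_neq : k != 1 -> spow k 2^-1 != 2^-1 :> R.
Proof.
move=> k1; rewrite spow_gt0 ?invr_gt0 ?ltr0n // -[X in _ != X]powRr1 ?invr_ge0 ?ler0n //.
have h0 : (2^-1 : R) == 0 = false by rewrite invr_eq0 pnatr_eq0.
rewrite /powR h0; apply: contra k1 => /eqP/expR_inj/mulIf -> //.
by rewrite lt_eqF // ln_lt0 // invr_gt0 ltr0n invf_lt1 ?ltr0n ?ltr1n.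
Qed.

Lemma phi_pl (x y : R) : phi (pl x y) = pl (spow k x) (spow k y).
Proof. by apply: row2P; rewrite phiE ?pl0 ?pl1. Qed.

(** In the gauge given by g, h, l the points are (0,0), (1,0), (0,1), (1,1/2). With linear weights
    [K_4] carries a self-stress, because rotations are motions too. For exponent k a stress
    satisfies w3 * (1 - 2 * eta) = 0 with eta = (1/2)^k, so it vanishes when [k != 1]. *)
Lemma K4_ex (v x y z : V) g h l : k != 1 ->
  x != v -> y != v -> z != v -> x != y -> x != z -> y != z ->
  exists p, indp p [set ed v x g; ed v y h; ed v z l;
    ed x y (g (+) h); ed x z (g (+) l); ed y z (h (+) l)].
Proof.
move=> k1 xv yv zv xy xz yz.
pose P0 := pl 0 0 : plane; pose P1 := pl 1 0 : plane; pose P2 := pl 0 1 : plane.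
pose P3 := pl 1 2^-1 : plane.
pose mk (a0 a1 a2 a3 : plane) : conf := [ffun t =>
  if t == v then a0 else if t == x then a1 else if t == y then a2 else a3].
have [mk0 mk1 mk2 mk3] : [/\ forall a0 a1 a2 a3, mk a0 a1 a2 a3 v = a0,
    forall a0 a1 a2 a3, mk a0 a1 a2 a3 x = a1,
    forall a0 a1 a2 a3, mk a0 a1 a2 a3 y = a2 &
    forall a0 a1 a2 a3, mk a0 a1 a2 a3 z = a3].
  split=> a0 a1 a2 a3; rewrite ffunE ?eqxx //.
  - by rewrite (negPf xv).
  - by rewrite (negPf yv) eq_sym (negPf xy).
  by rewrite (negPf zv) ![z == _]eq_sym (negPf xz) (negPf yz).
pose p := mk P0 (gact g P1) (gact h P2) (gact l P3).
exists p => w; rewrite -!setUA => hw.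
have sep (t a b : V) i j : a != b -> ed t a i != ed t b j.
  by move=> ab; apply: contra ab => /eqP/ed_inj1[_ ->].
pose T := ed x y (g (+) h) |: (ed x z (g (+) l) |: [set ed y z (h (+) l)]).
have vT : v \notin vs T.
  rewrite /T !vsU1 vs1 !ends_ed !inE !negb_or ![v == _]eq_sym.
  by rewrite xv yv zv.
have n5 : ed x z (g (+) l) \notin [set ed y z (h (+) l)].
  by rewrite in_set1 edC (edC y) sep.
have n4 : ed x y (g (+) h) \notin ed x z (g (+) l) |: [set ed y z (h (+) l)].
  by rewrite in_setU1 in_set1 negb_or sep //= edC sep.
have n3 := ed_notin z l vT.
have n2 : ed v y h \notin ed v z l |: T by rewrite in_setU1 negb_or sep ?ed_notin.
have n1 : ed v x g \notin ed v y h |: (ed v z l |: T).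
  by rewrite 2!in_setU1 2!negb_or (ed_notin x g vT) !sep.
pose eta := spow k 2^-1.
have etan : eta != 2^-1 by exact: spow_half_neq.
pose w1 := w (ed v x g); pose w2 := w (ed v y h); pose w3 := w (ed v z l).
pose w4 := w (ed x y (g (+) h)); pose w5 := w (ed x z (g (+) l)).
pose w6 := w (ed y z (h (+) l)).
have main (U0 U1 U2 U3 : plane) :
    w1 * dot (pl (-1) 0) (U0 - U1) + (w2 * dot (pl 0 (-1)) (U0 - U2) +
   (w3 * dot (pl (-1) (- eta)) (U0 - U3) + (w4 * dot (pl 1 (-1)) (U1 - U2) +
   (w5 * dot (pl 0 (- eta)) (U1 - U3) + w6 * dot (pl (-1) eta) (U2 - U3))))) = 0.
  have E := hw (mk U0 (lact g U1) (lact h U2) (lact l U3)).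
  rewrite (big_setU1 _ n1) (big_setU1 _ n2) (big_setU1 _ n3) (big_setU1 _ n4)
    (big_setU1 _ n5) big_set1 /= in E.
  move: E; rewrite !(rig_ed ax).
  have rv (t : V) i (Q U : plane) (u : conf) : p t = gact i Q -> u t = lact i U -> u v = U0 ->
      rowf p v t i u = dot (phi (P0 - Q)) (U0 - U).
    by move=> pt ut uv; rewrite /erow pt ut uv /p mk0 (gactK ax) (lactK ax).
  have rr (t t' : V) i j (Q Q' U U' : plane) (u : conf) : p t = gact i Q -> p t' = gact j Q' ->
      u t = lact i U -> u t' = lact j U' ->
      rowf p t t' (i (+) j) u = dot (phi (Q - Q')) (U - U').
    by move=> pt pt' ut ut'; rewrite (row_gauge ax) pt pt' ut ut' !(gactK ax) !(lactK ax).
  rewrite (rv x g P1 U1) ?mk0 ?mk1 // (rv y h P2 U2) ?mk0 ?mk2 // (rv z l P3 U3) ?mk0 ?mk3 //.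
  rewrite (rr x y g h P1 P2 U1 U2) ?mk1 ?mk2 // (rr x z g l P1 P3 U1 U3) ?mk1 ?mk3 //.
  rewrite (rr y z h l P2 P3 U2 U3) ?mk2 ?mk3 //.
  have plB (a0 a1 b0 b1 : R) : pl a0 a1 - pl b0 b1 = pl (a0 - b0) (a1 - b1).
    by apply: row2P; rewrite !mxE.
  rewrite /P0 /P1 /P2 /P3 !plB !phi_pl !subr0 !sub0r !subrr !spowN !spow0 !spow1.
  have -> : (1 - 2^-1 : R) = 2^-1 by lra.
  exact.
(* Unit displacements of v, x and y; those of z add nothing, by translation invariance. *)
pose e0 := pl 1 0 : plane; pose e1 := pl 0 1 : plane.
have q1 := main e0 0 0 0; have q2 := main e1 0 0 0; have q3 := main 0 e0 0 0.
have q4 := main 0 e1 0 0; have q5 := main 0 0 e0 0; have q6 := main 0 0 e1 0.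
rewrite !dotE !mxE /= in q1 q2 q3 q4 q5 q6.
have w3E : w3 * (1 - 2 * eta) = 0.
  have h1 : w1 = - w3 by lra.
  have h4 : w4 = w3 by lra.
  have h6 : w6 = - w3 by lra.
  have h2 : w2 = - (w3 * eta) by lra.
  rewrite h2 h4 h6 in q6; lra.
have w30 : w3 = 0.
  apply/eqP; move/eqP: w3E; rewrite mulf_eq0 => /orP[//|/eqP e].
  by case/eqP: etan; lra.
rewrite w30 in q1 q2 q3 q4 q5 q6.
have w10 : w1 = 0 by lra.
have w20 : w2 = 0 by lra.
have w40 : w4 = 0 by lra.
have w60 : w6 = 0 by rewrite w40 in q5; lra.
have w50 : w5 = 0.
  have : w5 * eta = 0 by rewrite w40 in q4; lra.
  move/eqP; rewrite mulf_eq0 => /orP[/eqP //|].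
  by rewrite (spow_eq0 k0) invr_eq0 pnatr_eq0.
move=> d; rewrite !in_setU1 in_set1.
by do 5![case/orP => [/eqP -> //|]] => /eqP ->.
Qed.


(** [A] collapses [W] to the contracted vertex, and [A + t *: B] replaces that point by a copy of
    [p1] of scale t, in the gauge [psi]. Rows of [F1] become exactly [spow k t] times those at [p1],
    so after rescaling they do not depend on t. At t = 0, displacements constant on [W] in the gauge
    kill the rows of [F1] and turn the others into rows of the contraction: the system is block
    triangular, hence independent, and openness yields a positive t. *)
Lemma contract_ex (W : {set V}) (w0 : V) (psi : {ffun V -> bool}) F F1 :
  w0 \in W -> (forall x, x \notin W -> psi x = false) ->
  F1 \subset F -> vs F1 \subset W -> potential F1 psi ->
  {in F :\: F1 &, injective (contract W w0 psi)} ->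
  (exists p, indp p F1) ->
  (exists p, indp p (contract W w0 psi @: (F :\: F1))) -> exists p, indp p F.
Proof.
move=> w0W psiW F1F F1W pot inj [p1 ip1] [p2 ip2].
pose kp := kap W w0; pose ct := contract W w0 psi; pose F2 := F :\: F1.
pose Q x := if x \in W then gact (psi x) (p1 x) else 0 : plane.
pose A : conf := [ffun x => gact (psi x) (p2 (kp x))].
pose B : conf := [ffun x => lact (psi x) (Q x)].
have AE x : gact (psi x) (A x) = p2 (kp x) by rewrite ffunE (gactK ax).
have PE (t : R) x : gact (psi x) ((A + t *: B) x) = p2 (kp x) + t *: Q x.
  by rewrite !ffunE (gactD ax) (lactZ ax) (lactK ax) (gactK ax).
have ends1 d : d \in F1 -> [/\ d.1.1 \in W, d.1.2 \in W &
    d.2 = psi d.1.1 (+) psi d.1.2].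
  move=> dF1; have /subsetP dW : ends d \subset W.
    by apply: subset_trans F1W; apply: (bigcup_sup d).
  split; [by rewrite dW ?inE ?eqxx | by rewrite dW ?inE ?eqxx ?orbT |].
  exact/eqP/(forall_inP pot).
have rig1 (t : R) d u : d \in F1 -> rigf (A + t *: B) d u = spow k t * rigf p1 d u.
  case/ends1 => d1 d2 dg; rewrite /rig dg !(row_gauge ax) !PE.
  rewrite /kp /kap /Q d1 d2 opprD addrACA subrr add0r -scalerBr phiZ.
  by rewrite dotZl.
have rig2 d (U : conf) :
    rigf A d [ffun x => lact (psi x) (U (kp x))] = rigf p2 (ct d) U.
  rewrite /ct /contract (rig_ed ax) /rig.
  have -> : d.2 = psi d.1.1 (+) (psi d.1.1 (+) d.2) by rewrite addKb.
  rewrite (row_gauge ax) AE !ffunE (lactK ax) -(lact_addb ax) -(gact_addb ax).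
  by rewrite /erow addKb (addbC d.2).
have rig1U d (U : conf) : d \in F1 ->
    rigf p1 d [ffun x => lact (psi x) (U (kp x))] = 0.
  case/ends1 => d1 d2 dg; rewrite /rig dg (row_gauge ax) !ffunE !(lactK ax).
  by rewrite /kp /kap d1 d2 subrr dot0r.
(* The rescaled rows, still independent at t = 0, where the true rows of [F1] vanish. *)
pose rho (t : R) (d : gedge V) u := if d \in F1 then rigf p1 d u else rigf (A + t *: B) d u.
have split2 (f : gedge V -> R) :
    \sum_(d in F) f d = \sum_(d in F1) f d + \sum_(d in F2) f d.
  by rewrite (big_setID F1) /= (setIidPr F1F).
have F2N d : d \in F2 -> (d \in F1) = false by rewrite in_setD => /andP[/negPf].
have rho0 : gindep F (rho 0).
  move=> w hw.
  have wF2 d : d \in F2 -> w d = 0.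
    (* Injectivity transports the coefficients to the contracted edges; the default 0 is never
       read. *)
    pose w' e := if [pick d in F2 | ct d == e] is Some d then w d else 0.
    have w'E d' : d' \in F2 -> w' (ct d') = w d'.
      rewrite /w' => dF; case: pickP => [d'' /andP[dF'' /eqP e]|/(_ d')].
        by rewrite (inj _ _ dF'' dF e).
      by rewrite dF eqxx.
    move=> dF2; rewrite -(w'E _ dF2); apply: (ip2 w'); last exact: imset_f.
    move=> U; have E := hw [ffun x => lact (psi x) (U (kp x))].
    rewrite split2 big1 ?add0r in E; last first.
      by move=> d' dF1; rewrite /rho dF1 rig1U // mulr0.
    rewrite big_imset //= -[RHS]E; apply: eq_bigr => d' dF'.
    by rewrite -/ct w'E // /rho (F2N _ dF') scale0r addr0 rig2.
  have wF1 d : d \in F1 -> w d = 0.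
    apply: ip1 => u; have E := hw u; rewrite split2 [X in _ + X]big1 ?addr0 in E.
      by rewrite -[RHS]E; apply: eq_bigr => d' dF1; rewrite /rho dF1.
    by move=> d' dF'; rewrite wF2 // mul0r.
  move=> d dF; have [/wF1 //|nF1] := boolP (d \in F1).
  by apply: wF2; rewrite in_setD nF1.
have /nbhs_norm0P[e /= e0 he] : \forall t \near (0 : R), gindep F (rho t).
  apply: (@gindep_near _ _ _ F rho) => //.
    by move=> t d c u u'; rewrite /rho; case: ifP => _; exact: (rig_lin ax).
  move=> d u _; rewrite /rho; case: (d \in F1); first exact: cvg_cst.
  exact: (rig_path_continuous k0 ax).
pose t := e / 2; have t0 : 0 < t by rewrite divr_gt0.
have it : gindep F (rho t).
  by apply: he; rewrite /= gtr0_norm // /t ltr_pdivrMr // mulr_natr mulr2n ltrDl.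
exists (A + t *: B) => w hw d dF.
pose w1 d := if d \in F1 then spow k t * w d else w d.
have w1d : w1 d = 0.
  apply: (it w1 _ d dF) => u; rewrite -[RHS](hw u); apply: eq_bigr => d' _.
  rewrite /w1 /rho; case: ifP => [dF1|_]; last by [].
  apply: (etrans _ (congr1 ( *%R (w d')) (esym (rig1 t d' u dF1)))).
  by rewrite mulrA (mulrC (w d')).
move: w1d; rewrite /w1; case: ifP => // _ /eqP.
by rewrite mulf_eq0 (spow_eq0 k0) (gt_eqF t0) => /eqP.
Qed.

Theorem gsparse_indep F : k != 1 -> oriented F -> gsparse F -> exists p, indp p F.
Proof.
move=> k1; move: F; apply: gsparse_ind => [|F v x g|F v x g y h|F v x g y h z l|v x g y h z l|].
- by exists 0; apply: indep0.
- exact: (ext1_ex k0 ax).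
- exact: (ext2_ex k0 ax).
- exact: (ext3_ex k0 ax).
- by move=> *; apply: K4_ex.
- exact: contract_ex.
Qed.

End Core.

(** * Kernels, potentials and symmetric motions *)

Section LinearBounds.
Variables (R : realType) (V T : finType) (F : {set T}).
Local Notation conf := {ffun V -> 'rV[R]_2}.
Variable rho : T -> conf -> R.
Hypothesis lin : forall d c u w, rho d (c *: u + w) = c * rho d u + rho d w.

Lemma gindep_card1 (u : conf) : gindep F rho ->
  (forall d, d \in F -> rho d u = 0) -> u != 0 -> (#|F| + 1 <= 2 * #|V|)%N.
Proof.
move=> ind ku u0; have [K [KP _ /(_ ind) <-]] := kernel_dim F lin.
rewrite addnC leq_add2r; have /dimvS : (<[u]> <= K)%VS by rewrite -memvE; apply/KP.
by rewrite dim_vline u0.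
Qed.

Lemma gindep_card2 (u u' : conf) : gindep F rho ->
  (forall d, d \in F -> rho d u = 0) -> (forall d, d \in F -> rho d u' = 0) ->
  u != 0 -> (forall c, u' != c *: u) -> (#|F| + 2 <= 2 * #|V|)%N.
Proof.
move=> ind ku ku' u0 ne; have [K [KP _ /(_ ind) <-]] := kernel_dim F lin.
rewrite addnC leq_add2r ltnNge; apply/negP => le1.
have uK : (<[u]> <= K)%VS by rewrite -memvE; apply/KP.
have /eqP KE : <[u]>%VS == K by rewrite eqEdim uK dim_vline u0.
have : u' \in K by apply/KP.
by rewrite -KE => /vlineP[c /eqP]; rewrite (negPf (ne c)).
Qed.

Lemma kernel_line (u : conf) : gindep F rho -> (#|F| + 1 = 2 * #|V|)%N ->
  (forall d, d \in F -> rho d u = 0) -> u != 0 ->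
  forall u', (forall d, d \in F -> rho d u' = 0) -> exists c, u' = c *: u.
Proof.
move=> ind cF ku u0 u' ku'; apply: contrapT => no.
have := gindep_card2 ind ku ku' u0; rewrite -cF leq_add2l => h.
by have /h : forall c, u' != c *: u by move=> c; apply/eqP => e; apply: no; exists c.
Qed.

Lemma kernel_plane (u : conf) : (#|F| + 2 <= 2 * #|V|)%N ->
  exists2 u', (forall d, d \in F -> rho d u' = 0) & forall c, u' != c *: u.
Proof.
move=> le; have [K [KP ge _]] := kernel_dim F lin.
have dK : (2 <= \dim K)%N by rewrite -(leq_add2r #|F|) addnC (leq_trans le).
have : ~~ (K <= <[u]>)%VS.
  apply/negP => /dimvS; rewrite dim_vline => h.
  by have := leq_trans dK h; case: (u != 0).
case/subvPn => u' /KP ku' nu; exists u' => // c; apply: contra nu => /eqP ->.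
by apply/vlineP; exists c.
Qed.

End LinearBounds.

(** * Balance as existence of a potential *)

Section GainGraph.
Variables (V E : finType) (G : gain_graph Cs V E).

(** Forgets the chosen orientation; that no two edges are identified is the content of the two
    axioms on parallel edges. *)
Definition rep (e : E) : gedge V := ed (src G e) (tgt G e) (gain G e).

Lemma Cs_inv (g : Cs) : (g^-1)%g = g. Proof. by []. Qed.

Lemma rep_inj : injective rep.
Proof.
move=> e f /ed_inj[gE [[sE tE]|[sE tE]]]; first exact: (@parallel_gain _ _ _ G).
by apply: (@parallel_gain_rev _ _ _ G); rewrite ?Cs_inv.
Qed.

Lemma ends_rep e : ends (rep e) = [set src G e; tgt G e].
Proof. exact: ends_ed. Qed.

Lemma rep_oriented (S : {set E}) : oriented (rep @: S).
Proof.
move=> _ /imsetP[e _ ->]; split; first exact: ed_idem.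
move/eqP; rewrite ed_loop ed2 => /eqP/(@loop_gain _ _ _ G) .
by case: (gain G e).
Qed.

Lemma subgraph_vs (W : {set V}) (S : {set E}) : subgraph G W S -> vs (rep @: S) \subset W.
Proof.
move=> sub; apply/bigcupsP => _ /imsetP[e eS ->]; rewrite ends_rep.
by have [sW tW] := sub e eS; rewrite subUset !sub1set sW.
Qed.

Lemma vs_subgraph (S : {set E}) : subgraph G (vs (rep @: S)) S.
Proof.
by move=> e eS; split; apply/vsP; exists (rep e); rewrite ?imset_f // ends_rep !inE eqxx ?orbT.
Qed.

Definition gain_potential (S : {set E}) (psi : V -> bool) :=
  forall e, e \in S -> gain G e = psi (src G e) (+) psi (tgt G e) :> bool.

Lemma potential_rep (S : {set E}) (psi : {ffun V -> bool}) :
  potential (rep @: S) psi <-> gain_potential S psi.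
Proof.
split=> [/forall_inP h e eS|h]; last apply/forall_inP => _ /imsetP[e eS ->].
  by apply/eqP; have := h _ (imset_f _ eS); rewrite potential_ed.
by rewrite potential_ed; apply/eqP; apply: h.
Qed.

(** The values of [psi] at intermediate vertices cancel in pairs along the walk. *)
Lemma walk_potential (S : {set E}) psi u w v : gain_potential S psi ->
  is_walk G S u w v -> net_gain G w = psi u (+) psi v :> bool.
Proof.
move=> pot; elim: w u => [|st w IH] u /=.
  by move/eqP => ->; rewrite addbb /net_gain big_nil.
case/and3P => stS /eqP <- /IH; rewrite /net_gain big_cons => IHw.
transitivity (step_gain G st (+) (psi (step_tgt G st) (+) psi v)); first by rewrite -IHw.
have := pot _ stS; case: st {stS IHw} => e b /=; rewrite /step_gain /step_tgt /step_src /=.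
by case: b => /= h; rewrite ?Cs_inv h; do 3 case: (psi _).
Qed.

Lemma potential_balanced (W : {set V}) (S : {set E}) psi :
  gain_potential S psi -> balanced G W S.
Proof.
move=> pot v _; apply/trivgP; rewrite gen_subG; apply/subsetP => g.
rewrite !inE => /asboolP[w ww <-].
by apply/eqP; rewrite (walk_potential pot ww) addbb.
Qed.

Lemma is_walk_cat (S : {set E}) u w v w' x : is_walk G S u w v -> is_walk G S v w' x ->
  is_walk G S u (w ++ w') x.
Proof.
elim: w u => [|st w IH] u /=; first by move/eqP => ->.
by case/and3P => -> -> /IH h /h.
Qed.

Lemma net_gain_cat w w' : net_gain G (w ++ w') = (net_gain G w (+) net_gain G w' : bool).
Proof. by rewrite /net_gain big_cat. Qed.

Definition rev_walk (w : seq (E * bool)) := rev [seq (st.1, ~~ st.2) | st <- w].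

Lemma is_walk_rev (S : {set E}) u w v : is_walk G S u w v -> is_walk G S v (rev_walk w) u.
Proof.
elim: w u => [|st w IH] u /=; first by move/eqP => ->; apply: eqxx.
case/and3P => stS /eqP <- /IH h; rewrite /rev_walk /= rev_cons -cats1.
apply: is_walk_cat h _; rewrite /= stS /step_src /step_tgt /=.
by case: st.2; rewrite /= !eqxx.
Qed.

Lemma net_gain_rev w : net_gain G (rev_walk w) = net_gain G w.
Proof.
elim: w => [|st w IH]; first by [].
rewrite /rev_walk /= rev_cons -cats1 net_gain_cat -/(rev_walk w) IH addbC.
rewrite [in RHS]/net_gain big_cons /net_gain big_seq1 /step_gain /=.
by case: st.2; rewrite /= ?Cs_inv.
Qed.

(** With a root in each component, [psi v] is the net gain of a walk from the root to v. Two such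
    walks differ by a closed walk, whose gain is trivial by balance. *)
Lemma balanced_potential (W : {set V}) (S : {set E}) : subgraph G W S ->
  balanced G W S -> exists psi, gain_potential S psi.
Proof.
move=> sub bal.
pose C x y := `[< exists w, is_walk G S x w y >].
have Crefl x : C x x by apply/asboolP; exists [::] => /=.
have Csym x y : C x y -> C y x.
  by move=> /asboolP[w ww]; apply/asboolP; exists (rev_walk w); apply: is_walk_rev.
have Ctrans x y z : C x y -> C y z -> C x z.
  move=> /asboolP[w ww] /asboolP[w' ww']; apply/asboolP; exists (w ++ w').
  exact: is_walk_cat ww ww'.
(* [pick] depends only on the predicate, so all vertices of a component receive the same root. *)
pose r v := odflt v [pick x | C x v].
have rC v : C (r v) v.
  by rewrite /r; case: pickP => [x //|/(_ v)]; rewrite Crefl.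
have rE u v : C u v -> r u = r v.
  move=> uv; rewrite /r.
  have e : (fun x => C x u) =1 (fun x => C x v).
    by move=> x; apply/idP/idP => h; [apply: Ctrans h uv | apply: Ctrans h (Csym _ _ uv)].
  rewrite (eq_pick e); case: pickP => [//|/(_ u)]; by rewrite uv.
pose psi v := `[< exists2 w, is_walk G S (r v) w v & net_gain G w = true >].
have closed v w : v \in W -> is_walk G S v w v -> net_gain G w = false.
  move=> vW ww; have : net_gain G w \in gain_space G S v.
    by apply: mem_gen; rewrite inE; apply/asboolP; exists w.
  by rewrite bal // inE => /eqP.
have walkW u w v : v \in W -> is_walk G S u w v -> u \in W.
  case: w => [|[e b] w] vW /=; first by move/eqP => ->.
  by case/and3P => eS /eqP <- _; have [sW tW] := sub e eS; rewrite /step_src; case: b.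
have psiE v w : v \in W -> is_walk G S (r v) w v -> psi v = net_gain G w.
  move=> vW ww; apply/idP/idP => [/asboolP[w' ww' gw']|gw]; last first.
    by apply/asboolP; exists w.
  have := closed (r v) (w ++ rev_walk w') (walkW _ _ _ vW ww)
    (is_walk_cat ww (is_walk_rev ww')).
  by rewrite net_gain_cat net_gain_rev gw'; case: (net_gain G w).
exists psi => e eS; have [sW tW] := sub e eS.
have st : is_walk G S (src G e) [:: (e, false)] (tgt G e) by rewrite /= eS /step_src /= !eqxx.
have rr : r (src G e) = r (tgt G e) by apply: rE; apply/asboolP; exists [:: (e, false)].
have /asboolP[w ww] := rC (src G e).
have ww' := is_walk_cat ww st.
rewrite (psiE _ _ sW ww); rewrite rr in ww'; rewrite (psiE _ _ tW ww').
by rewrite net_gain_cat addKb /net_gain big_seq1.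
Qed.

End GainGraph.

(** * Derived frameworks and symmetric motions *)

Section Framework.
Variables (R : realType) (V E : finType) (G : gain_graph Cs V E) (k : R).
Hypothesis k0 : 0 < k.
Variables (s : 'rV[R]_2 -> 'rV[R]_2) (n m : 'rV[R]_2).
Local Notation L := (linear_part s).
Hypothesis ax : axial k s L n m.

Local Notation plane := 'rV[R]_2.
Local Notation conf := {ffun V -> plane}.
Local Notation gact := (Cs_act s).
Local Notation lact := (lact L).
Local Notation rigf := (rig k s L).
Local Notation indp := (indep k s L).
Implicit Types (p u : conf) (F : {set gedge V}) (W : {set V}) (S : {set E}).

(** The count for [W] needs a configuration space of dimension 2|W|; extension by zero embeds it in
    that of [V]. *)
Definition extend W (u : {ffun {x : V | x \in W} -> plane}) : conf :=
  [ffun x => if insub x is Some y then u y else 0].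
Definition restrict W u : {ffun {x : V | x \in W} -> plane} := [ffun y => u (val y)].

Lemma extend_restrict W u x : x \in W -> extend (restrict W u) x = u x.
Proof. by move=> xW; rewrite ffunE insubT ffunE. Qed.

Lemma extend_lin W c (u w : {ffun {x : V | x \in W} -> plane}) :
  extend (c *: u + w) = c *: extend u + extend w.
Proof.
apply/ffunP => x; rewrite !ffunE; case: insubP => [y _ _|_]; first by rewrite !ffunE.
by rewrite scaler0 addr0.
Qed.

Lemma rig_extend p W F u d : vs F \subset W -> d \in F ->
  rigf p d (extend (restrict W u)) = rigf p d u.
Proof.
move=> /subsetP FW dF; rewrite /rig /erow !extend_restrict //; apply: FW; apply/vsP;
by exists d; rewrite // !inE eqxx ?orbT.
Qed.

Lemma gindep_restrict p W F : vs F \subset W -> indp p F ->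
  gindep F (fun d (u : {ffun {x : V | x \in W} -> plane}) => rigf p d (extend u)).
Proof.
move=> FW ip w hw; apply: ip => u; rewrite -[RHS](hw (restrict W u)).
by apply: eq_bigr => d dF; rewrite (rig_extend _ _ FW).
Qed.

Lemma indep_card1 p W F u x : vs F \subset W -> indp p F ->
  (forall d, d \in F -> rigf p d u = 0) -> x \in W -> u x != 0 ->
  (#|F| + 1 <= 2 * #|W|)%N.
Proof.
move=> FW ip ku xW ux; rewrite -[#|W|]card_sig.
apply: (gindep_card1 _ (gindep_restrict FW ip) (u := restrict W u)).
- by move=> d c u' w; rewrite extend_lin (rig_lin ax).
- by move=> d dF; rewrite (rig_extend _ _ FW) // ku.
apply: contra ux => /eqP e; rewrite -(extend_restrict u xW) e ffunE.
by case: insub => // y; rewrite ffunE.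
Qed.

Lemma indep_card2 p W F u u' x : vs F \subset W -> indp p F ->
  (forall d, d \in F -> rigf p d u = 0) -> (forall d, d \in F -> rigf p d u' = 0) ->
  x \in W -> u x != 0 -> (forall c, u' x != c *: u x) ->
  (#|F| + 2 <= 2 * #|W|)%N.
Proof.
move=> FW ip ku ku' xW ux ne; rewrite -[#|W|]card_sig.
apply: (gindep_card2 _ (gindep_restrict FW ip) (u := restrict W u) (u' := restrict W u')).
- by move=> d c u1 w; rewrite extend_lin (rig_lin ax).
- by move=> d dF; rewrite (rig_extend _ _ FW) // ku.
- by move=> d dF; rewrite (rig_extend _ _ FW) // ku'.
- apply: contra ux => /eqP e; rewrite -(extend_restrict u xW) e ffunE.
  by case: insub => // y; rewrite ffunE.
move=> c; apply: contra (ne c) => /eqP e.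
rewrite -(extend_restrict u' xW) -(extend_restrict u xW) e.
by have := extend_lin c (restrict W u) 0; rewrite addr0 => ->;
  rewrite !ffunE insubT !ffunE addr0.
Qed.

(** After switching, the gains are trivial and any translation [a] is a motion: the source of the 2
    in the balanced count. *)
Lemma rig_potential p F (psi : {ffun V -> bool}) (a : plane) d : potential F psi ->
  d \in F -> rigf p d [ffun x => lact (psi x) a] = 0.
Proof.
move=> /forall_inP pot dF; rewrite /rig (eqP (pot _ dF)) (row_gauge ax) !ffunE.
by rewrite !(lactK ax) subrr dot0r.
Qed.

Definition const_conf (a : plane) : conf := [ffun=> a].

(** A translation along the mirror is fixed by the reflection, whatever the gains: the source of the
    1 in the general count. *)
Lemma rig_const p d : rigf p d (const_conf m) = 0.
Proof.
rewrite /rig /erow !ffunE; suff -> : lact d.2 m = m by rewrite subrr dot0r.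
by case: d.2 => //=; apply: ax_m ax.
Qed.

Lemma const_conf_neq0 (v0 : V) : const_conf m != 0.
Proof.
apply: contra (ax_m0 ax) => /eqP/ffunP/(_ v0); by rewrite !ffunE => ->.
Qed.

Lemma set2_eq (T : finType) (a b c d : T) : [set a; b] = [set c; d] ->
  (a = c /\ b = d) \/ (a = d /\ b = c).
Proof.
move=> h; have : a \in [set c; d] by rewrite -h !inE eqxx.
have : b \in [set c; d] by rewrite -h !inE eqxx orbT.
have : c \in [set a; b] by rewrite h !inE eqxx.
have : d \in [set a; b] by rewrite h !inE eqxx orbT.
by rewrite !inE; do 4![case/orP=> /eqP ?]; subst; auto.
Qed.

(** The ends of a common derived edge match in one of two orders, and each order yields equality by
    one axiom on parallel edges. Deleting an orbit thus deletes a single edge of [G]. *)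
Lemma orbit_inj e f z : z \in edge_orbit G e -> z \in edge_orbit G f -> e = f.
Proof.
move=> /imsetP[g _ ->] /imsetP[h _] /set2_eq[[[gh sE] [gE tE]]|[[gh sE] [gE tE]]].
  by subst h; apply: (@parallel_gain _ _ _ G) => //; apply: (mulgI g).
apply: (@parallel_gain_rev _ _ _ G) => //; rewrite -gE in gh.
by apply: (mulgI g); apply: (mulIg (gain G f)); rewrite -gh mulgKV.
Qed.

Definition orbits S : {set {set Cs * V}} := \bigcup_(e in S) edge_orbit G e.

Lemma derived_orbits : derived_edges G = orbits [set: E].
Proof. by rewrite /derived_edges /orbits; apply: eq_bigl => e; rewrite inE. Qed.

Lemma derived_orbitsD1 e : derived_edges G :\: edge_orbit G e = orbits [set~ e].
Proof.
apply/setP => z; rewrite inE; apply/andP/bigcupP => [[ze /bigcupP[f _ zf]]|[f]].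
  by exists f => //; rewrite !inE; apply: contraNneq ze => <-.
rewrite !inE => fe zf; split; last by apply/bigcupP; exists f.
by apply: contra fe => ze; apply/eqP; apply: orbit_inj zf ze.
Qed.

Lemma orbitsP S x y : [set x; y] \in orbits S <->
  exists2 e, e \in S & exists g : Cs,
    (x = (g, src G e) /\ y = ((g * gain G e)%g, tgt G e)) \/
    (y = (g, src G e) /\ x = ((g * gain G e)%g, tgt G e)).
Proof.
split=> [/bigcupP[e eS /imsetP[g _ h]]|[e eS [g h]]].
  exists e => //; exists g.
  by case: (set2_eq h) => -[? ?]; [left | right].
apply/bigcupP; exists e => //; apply/imsetP; exists g => //.
by case: h => -[-> ->] //; rewrite setUC.
Qed.

Local Notation lift U := ([ffun z : Cs * V => lact z.1 (U z.2)] : {ffun Cs * V -> plane}).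

Lemma linear_part_act (g : Cs) (a : plane) : linear_part (gact g) a = lact g a.
Proof. by case: g; rewrite /linear_part /= ?subr0. Qed.

Lemma row_orbit p (U : conf) (g : Cs) e :
  dot (signed_pow k (derived_conf gact p (g, src G e) -
      derived_conf gact p ((g * gain G e)%g, tgt G e)))
    (lact g (U (src G e)) - lact (g * gain G e)%g (U (tgt G e))) = rigf p (rep G e) U.
Proof.
transitivity (erow k s L p (src G e) (tgt G e) ((g : bool) (+) (g * gain G e)%g) U).
  by rewrite (row_gauge ax).
have -> : (g : bool) (+) (g * gain G e)%g = gain G e by exact: addKb.
by rewrite -(rig_ed ax).
Qed.

(** The values on identity copies determine a symmetric motion, and all edges of an orbit impose the
    same equation. The exponent is [k + 1] because the weights use q - 1. *)
Lemma symmetric_motionP S p (u : {ffun Cs * V -> plane}) :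
  symmetric_motion (k + 1) gact (orbits S) (derived_conf gact p) u <->
  exists2 U : conf, u = lift U & forall e, e \in S -> rigf p (rep G e) U = 0.
Proof.
have kE : k + 1 - 1 = k by rewrite addrK.
split=> [[um us]|[U -> kU]].
  have uE : u = lift [ffun x => u (false, x)].
    apply/ffunP => -[g x]; rewrite !ffunE /= -linear_part_act -us /vertex_act /=.
    by case: g.
  exists [ffun x => u (false, x)] => // e eS.
  rewrite -(row_orbit p _ (1%g : Cs) e).
  have h : [set (1%g : Cs, src G e); ((1 * gain G e)%g, tgt G e)] \in orbits S.
    by apply/orbitsP; exists e => //; exists 1%g; left.
  have := um _ _ h; rewrite kE => <-; rewrite {3 4}uE.
  by rewrite [in RHS]ffunE [X in _ = dot _ (_ - X)]ffunE.
split=> [x y /orbitsP[e eS [g [[-> ->]|[-> ->]]]]|g x]; rewrite ?kE !ffunE /=.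
- by rewrite row_orbit kU.
- rewrite -opprB phiN -[X in dot _ X]opprB dotNl dotNr opprK.
  by rewrite row_orbit kU.
by rewrite linear_part_act -(lact_addb ax).
Qed.

(** The value of a constant symmetric motion, read off at [v0], is fixed by the reflection and hence
    a multiple of [m]. *)
Lemma rigidP S p (v0 : V) :
  symmetrically_rigid (k + 1) gact (orbits S) (derived_conf gact p) <->
  forall U : conf, (forall e, e \in S -> rigf p (rep G e) U = 0) ->
    exists c, U = c *: const_conf m.
Proof.
split=> [rig U kU|h u /symmetric_motionP[U -> kU]].
  have h := rig (lift U) (_ : symmetric_motion _ _ _ _ _).
  have {}h x y : lift U x = lift U y by apply: h; apply/symmetric_motionP; exists U.
  have fixU : L (U v0) = U v0 by have := h (true : Cs, v0) (false : Cs, v0); rewrite !ffunE.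
  have [c cE] := ax_fix ax fixU; exists c; apply/ffunP => x; rewrite !ffunE -cE.
  by have := h (false : Cs, x) (false : Cs, v0); rewrite !ffunE.
have [c ->] := h U kU => -[g x] [g' x']; rewrite !ffunE !(lactZ ax).
have lm (i : bool) : lact i m = m by case: i => //=; apply: ax_m ax.
by rewrite !lm.
Qed.

End Framework.

(** * The two directions of the characterization *)

Section Characterization.
Variables (R : realType) (V E : finType) (G : gain_graph Cs V E) (k : R).
Hypothesis k0 : 0 < k.
Variables (s : 'rV[R]_2 -> 'rV[R]_2) (n m : 'rV[R]_2).
Local Notation L := (linear_part s).
Hypothesis ax : axial k s L n m.

Local Notation plane := 'rV[R]_2.
Local Notation conf := {ffun V -> plane}.
Local Notation gact := (Cs_act s).
Local Notation lact := (lact L).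
Local Notation rigf := (rig k s L).
Local Notation indp := (indep k s L).
Local Notation cm := (const_conf V m).
Local Notation FE := (rep G @: [set: E]).
Local Notation lift U := ([ffun z : Cs * V => lact z.1 (U z.2)] : {ffun Cs * V -> plane}).
Implicit Types (p u U : conf) (F H : {set gedge V}) (W : {set V}) (S : {set E}).

Lemma rig_constZ p d c : rigf p d (c *: cm) = 0.
Proof.
have r0 : rigf p d 0 = 0.
  by have := rig_lin ax p d 1 0 0; rewrite scale1r addr0 mul1r; lra.
by rewrite -[c *: _]addr0 (rig_lin ax) r0 (rig_const ax) mulr0 addr0.
Qed.

Lemma indepS p F H : H \subset F -> indp p F -> indp p H.
Proof.
move=> HF ip w hw d dH; pose w' d := if d \in H then w d else 0.
have : w' d = 0.
  apply: (ip w' _ d (subsetP HF _ dH)) => u; rewrite (big_setID H) /= (setIidPr HF).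
  rewrite [X in _ + X]big1 ?addr0; last first.
    by move=> d'; rewrite inE /w' => /andP[/negPf -> _]; rewrite mul0r.
  by rewrite -[RHS](hw u); apply: eq_bigr => d' d'H; rewrite /w' d'H.
by rewrite /w' dH.
Qed.

Lemma gain_tight_gsparse : gain_tight G 2 2 1 -> gsparse FE.
Proof.
move=> [[sp _] bs] H HF H0.
pose S := [set e | rep G e \in H].
have HE : H = rep G @: S.
  apply/setP => d; apply/idP/imsetP => [dH|[e]]; last by rewrite inE => ? ->.
  have /imsetP[e _ dE] := subsetP HF _ dH.
  by exists e; rewrite // inE -dE.
have cH : #|H| = #|S| by rewrite HE (card_imset _ (@rep_inj _ _ G)).
have S0 : (1 <= #|S|)%N by rewrite -cH card_gt0.
have sub : subgraph G (vs H) S by rewrite HE; apply: vs_subgraph.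
rewrite cH; split; first exact: sp (subsetT _) (subsetT _) sub S0.
move=> /existsP[psi]; rewrite {1}HE => /potential_rep pot.
exact: (bs _ _ sub (potential_balanced (W := vs H) pot) _ _ (subxx _) (subxx _) sub S0).
Qed.

(** An edge with coinciding ends has a zero row. Regularity compares only with well-positioned
    configurations, so the independent one must qualify. *)
Lemma indep_well_positioned p : indp p FE ->
  well_positioned (derived_edges G) (derived_conf gact p).
Proof.
move=> ip x y; rewrite derived_orbits => /orbitsP[e _ [g xy]].
apply/negP => /eqP pxy.
have rig0 u : rigf p (rep G e) u = 0.
  rewrite -(row_orbit G ax p u g e).
  have -> : derived_conf gact p (g, src G e) =
      derived_conf gact p ((g * gain G e)%g, tgt G e).
    by case: xy => -[<- <-].
  have phi0 : signed_pow k (0 : plane) = 0.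
    by rewrite -[X in signed_pow k X](scale0r 0) phiZ spow0 scale0r.
  by rewrite subrr phi0 dot0l.
have eF : rep G e \in FE by rewrite imset_f // inE.
pose w (d : gedge V) : R := (d == rep G e)%:R.
have : w (rep G e) = 0.
  apply: (ip w _ _ eF) => u; rewrite big1 // => d _.
  by rewrite /w; case: eqP => [->|_]; rewrite ?rig0 ?mulr0 ?mul0r.
by move/eqP; rewrite /w eqxx oner_eq0.
Qed.

Lemma lift_cm_neq0 (v0 : V) : lift cm != 0.
Proof.
apply: contra (const_conf_neq0 ax v0) => /eqP/ffunP h; apply/eqP/ffunP => x.
by have := h (false : Cs, x); rewrite !ffunE.
Qed.

Lemma liftZ c U : lift (c *: U) = c *: lift U.
Proof. by apply/ffunP => z; rewrite !ffunE (lactZ ax). Qed.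

Lemma card_rep S : #|rep G @: S| = #|S|.
Proof. exact: card_imset (@rep_inj _ _ G). Qed.

Lemma rep_ker S p U : (forall e, e \in S -> rigf p (rep G e) U = 0) <->
  (forall d, d \in rep G @: S -> rigf p d U = 0).
Proof.
split=> [h _ /imsetP[e eS ->]|h e eS]; first exact: h.
by apply: h; apply: imset_f.
Qed.

(** So few equations leave at least two dimensions of motions, more than the line of
    translations. *)
Lemma not_rigid S p (v0 : V) : (#|S| + 2 <= 2 * #|V|)%N ->
  ~ symmetrically_rigid (k + 1) gact (orbits G S) (derived_conf gact p).
Proof.
move=> le /(rigidP G ax S p v0) rig.
have le' : (#|rep G @: S| + 2 <= 2 * #|V|)%N by rewrite card_rep.
have [U kU nU] := kernel_plane (rig_lin ax p) cm le'.
have [|c UE] := rig U; first exact/rep_ker.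
by have := nU c; rewrite UE eqxx.
Qed.

(** An independent placement has a motion space of dimension one, so by regularity that of [p] is at
    most one; it contains the translations along the mirror and therefore equals them. Dropping an
    orbit leaves too few equations. *)
Lemma gain_tight_rigid p (v0 : V) : k != 1 -> gain_tight G 2 2 1 ->
  regular_conf (k + 1) gact (derived_edges G) (derived_conf gact p) ->
  minimally_symmetrically_rigid (k + 1) gact G (derived_conf gact p).
Proof.
move=> k1 gt [d [K KP dK] dmin].
have [p' ip'] := gsparse_indep k0 ax k1 (@rep_oriented _ _ G _) (gain_tight_gsparse gt).
have cE : (#|E| + 1 = 2 * #|V|)%N by case: gt => -[].
have cF : (#|FE| + 1 = 2 * #|V|)%N by rewrite card_rep cardsT.
have kcm (q : conf) e : e \in FE -> rigf q e cm = 0 by move=> _; apply: rig_const ax _ _.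
have line := kernel_line (rig_lin ax p') ip' cF (kcm p') (const_conf_neq0 ax v0).
have d1 : (d <= 1)%N.
  apply: (dmin (derived_conf gact p')).
  - exact: indep_well_positioned.
  - by move=> g x; rewrite /derived_conf -(gact_addb ax).
  exists <[lift cm]>%VS; last by rewrite dim_vline (lift_cm_neq0 v0).
  move=> u; rewrite derived_orbits; split=> [/vlineP[c ->]|].
    apply/(symmetric_motionP G ax _ _ _); exists (c *: cm); first by rewrite liftZ.
    by move=> e _; apply: rig_constZ.
  move=> /(symmetric_motionP G ax _ _ _)[U -> kU].
  have [|c ->] := line U; first exact/rep_ker.
  by rewrite liftZ; apply/vlineP; exists c.
split.
  rewrite derived_orbits; apply/(rigidP G ax _ p v0) => U kU.
  have cK : lift cm \in K.
    apply/KP; rewrite derived_orbits; apply/(symmetric_motionP G ax _ _ _).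
    by exists cm => // e _; apply: rig_const ax _ _.
  have KE : (<[lift cm]> = K)%VS.
    by apply/eqP; rewrite eqEdim -memvE cK dim_vline (lift_cm_neq0 v0) dK.
  have : lift U \in K.
    by apply/KP; rewrite derived_orbits; apply/(symmetric_motionP G ax _ _ _); exists U.
  rewrite -KE => /vlineP[c cU]; exists c; apply/ffunP => x.
  by move/ffunP/(_ (false : Cs, x)): cU; rewrite !ffunE.
move=> e; rewrite derived_orbitsD1; apply: (not_rigid v0).
rewrite cardsC1 -cE; have : (0 < #|E|)%N by apply/card_gt0P; exists e.
by case: #|E| => // j _; rewrite /= addn2 addn1.
Qed.

(** If an edge had a nonzero coefficient in a relation, its equation would follow from the others,
    and deleting its orbit would preserve rigidity. *)
Lemma minimally_rigid_indep p (v0 : V) :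
  minimally_symmetrically_rigid (k + 1) gact G (derived_conf gact p) -> indp p FE.
Proof.
move=> [rig mini] w hw _ /imsetP[e _ ->]; apply/eqP; apply: contraT => wn.
case: (mini e); rewrite derived_orbitsD1; apply/(rigidP G ax _ p v0) => U kU.
move: rig; rewrite derived_orbits => /(rigidP G ax _ p v0); apply => f _.
have [->|fe] := eqVneq f e; last by apply: kU; rewrite !inE.
have := hw U; rewrite (bigD1 (rep G e)) ?imset_f ?inE //= big1 ?addr0.
  by move/eqP; rewrite mulf_eq0 (negPf wn) => /eqP.
move=> d /andP[/imsetP[f' _ ->] fe']; rewrite kU ?mulr0 // !inE.
by apply: contra fe' => /eqP ->.
Qed.

(** Independence bounds the edges on W by 2|W| minus the dimension of the translations they admit,
    one in general and two if balanced. Rigidity gives the reverse inequality for the whole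
    graph. *)
Lemma minimally_rigid_gain_tight p (v0 : V) :
  minimally_symmetrically_rigid (k + 1) gact G (derived_conf gact p) -> gain_tight G 2 2 1.
Proof.
move=> mr; have ip := minimally_rigid_indep v0 mr; case: mr => rig _.
have sub S : rep G @: S \subset FE by apply: imsetS; apply: subsetT.
have src_in W S : subgraph G W S -> (1 <= #|S|)%N -> exists x, x \in W.
  move=> sg; rewrite card_gt0 => /set0Pn[e eS].
  by exists (src G e); have [] := sg e eS.
have m0 := ax_m0 ax.
split; first split.
- move=> W S _ _ sg S0; have [x xW] := src_in _ _ sg S0.
  rewrite -card_rep; apply: (indep_card1 ax (subgraph_vs sg) (indepS (sub S) ip) (u := cm)).
  + by move=> d _; apply: rig_const ax _ _.
  + exact: xW.
  by rewrite ffunE.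
- have le : (#|E| + 1 <= 2 * #|V|)%N.
    have := @indep_card1 _ _ _ _ _ _ ax p [set: V] FE cm v0 (subsetT _) ip.
    rewrite card_rep !cardsT; apply; rewrite ?inE ?ffunE //.
    by move=> d _; apply: rig_const ax _ _.
  apply/eqP; rewrite eqn_leq le /= leqNgt; apply/negP => lt.
  move: rig; rewrite derived_orbits; apply: (not_rigid v0).
  by rewrite cardsT addnS.
move=> W S sgW bs; have [psi0 pot0] := balanced_potential sgW bs.
pose psi := [ffun x => psi0 x] : {ffun V -> bool}.
have pot : gain_potential G S psi by move=> e eS; rewrite !ffunE; apply: pot0.
move=> W' S' _ sS sg S0; have [x xW] := src_in _ _ sg S0.
have pot' : potential (rep G @: S') psi.
  by apply/potential_rep => e /(subsetP sS); apply: pot.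
have ker a d : d \in rep G @: S' -> rigf p d [ffun x => lact (psi x) a] = 0.
  exact: (rig_potential ax p a pot').
rewrite -card_rep.
apply: (indep_card2 ax (subgraph_vs sg) (indepS (sub S') ip) (ker (pl 1 0)) (ker (pl 0 1)) xW).
  rewrite ffunE; apply/eqP => /(congr1 (lact (psi x))); rewrite (lactK ax) (lact0 ax).
  by move/rowP/(_ 0); rewrite !mxE /= => /eqP; rewrite oner_eq0.
move=> c; rewrite !ffunE -(lactZ ax); apply/eqP => /(congr1 (lact (psi0 x))).
rewrite !(lactK ax) => /rowP/(_ 1); rewrite !mxE /= mulr0 => /eqP.
by rewrite oner_eq0.
Qed.

End Characterization.

Theorem theorem6p1 (R : realType) (q : R) (s : 'rV[R]_2 -> 'rV[R]_2)
    (V E : finType) (G : gain_graph Cs V E) (p : V -> 'rV[R]_2) :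
  1 < q -> q != 2 ->
  is_reflection s -> lq_isometry q s ->
  (0 < #|V|)%N ->
  well_positioned (derived_edges G) (derived_conf (Cs_act s) p) ->
  regular_conf q (Cs_act s) (derived_edges G) (derived_conf (Cs_act s) p) ->
  minimally_symmetrically_rigid q (Cs_act s) G (derived_conf (Cs_act s) p) <->
  gain_tight G 2 2 1.
Proof.
move=> q1 q2 refl iso V0 _.
have [n [m ax]] := axial_reflection q1 q2 refl iso.
have k0 : 0 < q - 1 by rewrite subr_gt0.
have k1 : q - 1 != 1 by rewrite subr_eq.
have [v0 _] : exists v : V, v \in predT by apply/card_gt0P.
pose pf : {ffun V -> 'rV[R]_2} := [ffun x => p x].
have -> : derived_conf (Cs_act s) p = derived_conf (Cs_act s) pf.
  by apply: funext => z; rewrite /derived_conf ffunE.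
rewrite -[in regular_conf q](subrK 1 q) -[in minimally_symmetrically_rigid q](subrK 1 q).
move=> reg; split=> [|gt].
  exact: (minimally_rigid_gain_tight ax v0).
exact: (gain_tight_rigid k0 ax v0 k1 gt reg).
Qed.
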